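(* For any distribution $J$ of prediction-state pairs $(v,y)\in[0,1]\times\{0,1\}$, $$\tfrac13\,\underline{\mathrm{distCal}}(J)\le\tfrac23\,\mathrm{smCal}(J)\le\ell_1\text{-}\mathrm{ATB}(J)\le3\,\underline{\mathrm{distCal}}(J)\le6\,\mathrm{smCal}(J),$$ $$\tfrac1{18}\,\underline{\mathrm{distCal}}(J)^2\le\tfrac29\,\mathrm{smCal}(J)^2\le\mathrm{ATB}(J)\le3\,\underline{\mathrm{distCal}}(J)\le6\,\mathrm{smCal}(J).$$
   Context: A distribution of $(v,y)\in[0,1]\times\{0,1\}$ is calibrated if $\mathbb E[y\mid v]=v$ almost surely. For a distribution $J$ of $(v,y)\in[0,1]\times\{0,1\}$: Averaged two-bin calibration error and its $\ell_1$ variant: $$\mathrm{ATB}(J)=\mathbb E_{q\sim\mathrm{Unif}([0,1])}\Big[\big(\mathbb E_J[(v-y)\mathbb I[v<q]]\big)^2+\big(\mathbb E_J[(v-y)\mathbb I[v\ge q]]\big)^2\Big],$$ $$\ell_1\text{-}\mathrm{ATB}(J)=\mathbb E_{q\sim\mathrm{Unif}([0,1])}\Big[\big|\mathbb E_J[(v-y)\mathbb I[v<q]]\big|+\big|\mathbb E_J[(v-y)\mathbb I[v\ge q]]\big|\Big].$$ Smooth calibration error: $\mathrm{smCal}(J)=\sup_{w\in W_1}\mathbb E_J[(v-y)w(v)]$, where $W_1$ is the family of $1$-Lipschitz functions $w:[0,1]\to[-1,1]$. (Lower) distance to calibration: $\underline{\mathrm{distCal}}(J)=\inf_\Pi\mathbb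 E_\Pi|u-v|$, where the infimum is over joint distributions $\Pi$ of $(u,v,y)\in[0,1]\times[0,1]\times\{0,1\}$ such that $(v,y)$ has distribution $J$ and the distribution of $(u,y)$ is calibrated. *)

(* Defs.v *)
From HB Require Import structures.
From mathcomp Require Import all_boot all_order all_algebra.
From mathcomp Require Import all_classical all_reals all_analysis.
Set Implicit Arguments.
Unset Strict Implicit.
Unset Printing Implicit Defensive.
Import Order.TTheory GRing.Theory Num.Theory numFieldNormedType.Exports.
Local Open Scope classical_set_scope.
Local Open Scope ring_scope.

(* A distribution on [0,1] x {0,1} is a Borel probability measure on
   R * bool that gives mass 1 to [pairs]; [true] is the state 1.  Integrands
   are integrated over the support only, so that values of test functions
   outside [0,1] are irrelevant. *)
Definition pairs {R : realType} : set (R * bool) :=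
  `[0, 1]%classic `*` [set: bool].

Definition triples {R : realType} : set (R * R * bool) :=
  (`[0, 1]%classic `*` `[0, 1]%classic) `*` [set: bool].

(* [g \o X] is a version of the conditional expectation E[Y | X], where Y is
   integrable. *)
Definition is_cond_expectation d d' (T : measurableType d)
    (T' : measurableType d') (R : realType) (P : probability T R)
    (Y : T -> R) (X : T -> T') (g : T' -> R) : Prop :=
  [/\ measurable_fun setT g,
      P.-integrable setT (EFin \o (g \o X)) &
      forall A, measurable A ->
        (\int[P]_(t in X @^-1` A) (g (X t))%:E =
         \int[P]_(t in X @^-1` A) (Y t)%:E)%E].

Definition calibrated {R : realType} (J : probability (R * bool)%type R) :
    Prop :=
  exists g : R -> R,
    is_cond_expectation J (fun z => z.2%:R) fst g /\
    {ae J, forall z, g z.1 = z.1}.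

Definition bin_lt {R : realType} (J : probability (R * bool)%type R) (q : R) :
    R :=
  \int[J]_(z in pairs) ((z.1 - z.2%:R) * (z.1 < q)%R%:R).

Definition bin_ge {R : realType} (J : probability (R * bool)%type R) (q : R) :
    R :=
  \int[J]_(z in pairs) ((z.1 - z.2%:R) * (q <= z.1)%R%:R).

Definition ATB {R : realType} (J : probability (R * bool)%type R) : R :=
  \int[uniform_prob (@ltr01 R)]_q (bin_lt J q ^+ 2 + bin_ge J q ^+ 2).

Definition l1_ATB {R : realType} (J : probability (R * bool)%type R) : R :=
  \int[uniform_prob (@ltr01 R)]_q (`|bin_lt J q| + `|bin_ge J q|).

Definition W1 {R : realType} : set (R -> R) :=
  [set w : R -> R | 1.-lipschitz_(`[0, 1]%classic) w /\
    forall v : R, 0 <= v <= 1 -> -1 <= w v <= 1].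

Definition smCal {R : realType} (J : probability (R * bool)%type R) : R :=
  sup [set \int[J]_(z in pairs) ((z.1 - z.2%:R) * w z.1) | w in W1].

Definition proj_uy {R : realType} (z : R * R * bool) : R * bool :=
  (z.1.1, z.2).

Definition proj_vy {R : realType} (z : R * R * bool) : R * bool :=
  (z.1.2, z.2).

Lemma measurable_proj_uy {R : realType} : measurable_fun setT (@proj_uy R).
Proof.
apply/measurable_fun_pair; last exact: measurable_snd.
exact: measurableT_comp measurable_fst measurable_fst.
Qed.

HB.instance Definition _ {R : realType} :=
  isMeasurableFun.Build _ _ _ _ (@proj_uy R) measurable_proj_uy.

Lemma measurable_proj_vy {R : realType} : measurable_fun setT (@proj_vy R).
Proof.
apply/measurable_fun_pair; last exact: measurable_snd.
exact: measurableT_comp measurable_snd measurable_fst.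
Qed.

HB.instance Definition _ {R : realType} :=
  isMeasurableFun.Build _ _ _ _ (@proj_vy R) measurable_proj_vy.

Definition calibrated_couplings {R : realType}
    (J : probability (R * bool)%type R) :
    set (probability (R * R * bool)%type R) :=
  [set Pi : probability (R * R * bool)%type R | [/\ Pi triples = 1%E,
      forall A, measurable A -> distribution Pi proj_vy A = J A &
      calibrated (distribution Pi proj_uy)]].

Definition distCal {R : realType} (J : probability (R * bool)%type R) : R :=
  inf [set \int[Pi]_(z in triples) `|z.1.1 - z.1.2|
        | Pi in calibrated_couplings J].

(* Main.v *)
Require Import Defs.
From HB Require Import structures.
From mathcomp Require Import all_boot all_order all_algebra.
From mathcomp Require Import all_classical all_reals all_analysis.
From mathcomp Require Import measurable_realfun ring lra.
Set Implicit Arguments.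
Unset Strict Implicit.
Unset Printing Implicit Defensive.
Import Order.TTheory GRing.Theory Num.Theory numFieldNormedType.Exports.
Local Open Scope classical_set_scope.
Local Open Scope ring_scope.

(* [distCal <= 2 smCal]: round [v] to a grid of mesh [1/n]. Moving each cell
   and state to calibrated grid points [u] at minimal cost is a finite linear
   program. A dual solution [(r, s)] satisfies
   [r v y <= |u - v| + s u * (y - u)] for all [u]; then [r v 1 - r v 0], made
   2-Lipschitz and clipped to [[-2, 2]], is twice a test function of [smCal]
   and dominates the dual value, up to [O(1/n)].

   [smCal <= 3/2 l1_ATB]: for [w] of class C^1,
   [2 w v = w 0 + w 1 + \int w' q (1[q <= v] - 1[v < q]) dq], so
   [2 E[(v - y) w v] = m (w 0 + w 1) + \int w' q (bin_ge q - bin_lt q) dq] with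
   [m = E[v - y] = bin_lt q + bin_ge q], whence [|m| <= l1_ATB].

   [l1_ATB <= 3 distCal]: under a calibrated coupling,
   [bin_lt q = E[(v - u) 1[v < q]] + E[(u - y) (1[v < q] - 1[u < q])]], and
   [\int |1[v < q] - 1[u < q]| dq = |u - v|]; similarly for [bin_ge]. *)

(** * Linear programming duality *)

(** The one object to construct is a coupling with a prescribed marginal and an exact calibration
    constraint. On the continuum this calls for infinite-dimensional duality; on a grid Farkas'
    lemma is enough. Calibration survives the passage back exactly, because it concerns only the law
    of [(u, y)], which the finite plan prescribes; rounding is paid for in the cost, and vanishes
    with the mesh. The same construction shows that calibrated couplings exist, without which the
    infimum would carry no information. The constant 3 is 1 + 2: the displacement [|u - v|] is
    charged in only one of two complementary bins, the threshold mismatch in both. The constant 3/2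
    is half of 3: [|w 0 + w 1| <= 2] contributes [l1_ATB] twice, the integral once. Test functions
    are merely Lipschitz, so class C^1 is reached by moving averages, which keep the Lipschitz
    constant. The quadratic chain follows from the linear one by [ATB <= l1_ATB], as bins are at
    most 1 in absolute value, and [l1_ATB ^+ 2 <= 2 * ATB]. *)

(* Induction on the number of constraints, after Bartl: if dropping [i] breaks
   the implication, some [x0] with [alpha i x0 = 1] shows it, and projecting
   along [x0] onto the kernel of [alpha i] reduces to the remaining ones. *)
Lemma farkas (R : realFieldType) (V : lmodType R) (I : eqType) (s : seq I)
    (alpha : I -> V -> R) (gamma : V -> R) :
  uniq s -> (forall i, scalar (alpha i)) -> scalar gamma ->
  (forall x, (forall i, i \in s -> alpha i x <= 0) -> gamma x <= 0) ->
  exists2 u : I -> R, (forall i, 0 <= u i) &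
    forall x, gamma x = \sum_(i <- s) u i * alpha i x.
Proof.
elim: s alpha gamma => [|i s IH] alpha gamma.
  move=> _ _ lin_gamma gamma_le0; exists (fun=> 0) => // x.
  rewrite big_nil; apply/eqP; rewrite eq_le gamma_le0//=.
  have /gamma_le0 : forall i : I, i \in [::] -> alpha i (- x) <= 0 by [].
  have g0 : gamma 0 = 0 by have := lin_gamma 1 0 0; rewrite scale1r addr0 mul1r; lra.
  have -> : - x = (-1) *: x + 0 by rewrite scaleN1r addr0.
  by rewrite lin_gamma g0; lra.
move=> /= /andP[is_ us] lin_alpha lin_gamma gamma_le0.
have [gamma_le0'|] :=
    pselect (forall x, (forall j, j \in s -> alpha j x <= 0) -> gamma x <= 0).
  have [u u0 uE] := IH alpha gamma us lin_alpha lin_gamma gamma_le0'.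
  exists (fun j => if j == i then 0 else u j) => [j|x]; first by case: ifP.
  rewrite big_cons eqxx mul0r add0r uE; apply: eq_big_seq => j js.
  by case: eqP => // ji; rewrite -ji js in is_.
move=> /existsNP[y /not_implyP[ys /negP]]; rewrite -ltNge => gy.
have scaleE (f : V -> R) (a : R) x : scalar f -> f (a *: x) = a * f x.
  move=> lf; have f0 : f 0 = 0 by have := lf 1 0 0; rewrite scale1r addr0 mul1r; lra.
  by rewrite -[a *: x]addr0 lf f0 addr0.
have iy : 0 < alpha i y.
  rewrite ltNge; apply/negP => iy; move: gy; rewrite ltNge => /negP; apply.
  by apply: gamma_le0 => j; rewrite inE => /predU1P[->//|]; exact: ys.
pose x0 := (alpha i y)^-1 *: y.
have x0i : alpha i x0 = 1 by rewrite scaleE// mulVf// gt_eqF.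
have x0s j : j \in s -> alpha j x0 <= 0.
  by move=> /ys jy; rewrite scaleE// mulr_ge0_le0// invr_ge0 ltW.
have x0g : 0 < gamma x0 by rewrite scaleE// mulr_gt0// invr_gt0.
pose proj (f : V -> R) x := f x - f x0 * alpha i x.
have lin_proj f : scalar f -> scalar (proj f).
  by move=> lf a x z; rewrite /proj lf lin_alpha; ring.
have projE f x : scalar f -> f ((- alpha i x) *: x0 + x) = proj f x.
  by move=> lf; rewrite lf /proj; ring.
have [|u u0 uE] := IH (proj \o alpha) (proj gamma) us
    (fun j => lin_proj _ (lin_alpha j)) (lin_proj _ lin_gamma).
  move=> x xs; rewrite -projE//; apply: gamma_le0 => j; rewrite inE.
  case/predU1P => [->|js]; last by rewrite projE//; exact: xs.
  by rewrite lin_alpha x0i; lra.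
(* Evaluating the desired identity at [x0], where [alpha i] is 1, forces this multiplier of [i]. It
   is nonnegative because [gamma x0 > 0] and every other [alpha k x0] is at most 0. *)
exists (fun j => if j == i then gamma x0 - \sum_(k <- s) u k * alpha k x0
                 else u j) => [j|x].
  case: ifP => // _; rewrite subr_ge0 (le_trans _ (ltW x0g))// big_seq.
  by rewrite sumr_le0// => k ks; rewrite mulr_ge0_le0// x0s.
rewrite big_cons eqxx.
have -> : \sum_(j <- s) (if j == i then gamma x0 - \sum_(k <- s) u k * alpha k x0
    else u j) * alpha j x = \sum_(j <- s) u j * alpha j x.
  by apply: eq_big_seq => j js; case: eqP => // ji; rewrite -ji js in is_.
have := uE x; rewrite /proj /= => /eqP; rewrite subr_eq => /eqP ->.
under eq_bigr do rewrite mulrBr mulrA.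
by rewrite sumrB -mulr_suml; ring.
Qed.

(** The scale [l] makes the dual constraints a cone, the form that [farkas] handles; its case
    [l = 0] carries the feasibility of the primal. The plan [g] consists of the Farkas multipliers
    of the constraints indexed by [(x, u)]. *)
Lemma transport_duality (R : realFieldType) (X U : finType) (c d : X -> U -> R)
    (p : X -> R) (B : R) :
  (forall (r : X -> R) (s : U -> R) (l : R), 0 <= l ->
    (forall x u, r x <= l * c x u + s u * d x u) ->
    \sum_x r x * p x <= l * B) ->
  exists g : X -> U -> R, [/\ forall x u, 0 <= g x u,
    forall x, \sum_u g x u = p x,
    forall u, \sum_x g x u * d x u = 0 &
    \sum_x \sum_u g x u * c x u <= B].
Proof.
move=> dual.
(* A vector [z] packs the dual variables: [r] in the [inl] coordinates, [s] in the [inr] ones, and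
   [l] at [None]. The constraint [None] is [0 <= l]. *)
pose V := {ffun option (X + U) -> R}.
pose alpha (i : option (X * U)) (z : V) : R :=
  if i is Some (x, u)
  then z (Some (inl x)) - z None * c x u - z (Some (inr u)) * d x u
  else - z None.
pose gamma (z : V) : R := \sum_x z (Some (inl x)) * p x - z None * B.
have alphaP i : scalar (alpha i).
  by case: i => [[x u]|] a z1 z2 /=; rewrite !ffunE /GRing.scale/=; ring.
have gammaP : scalar gamma.
  move=> a z1 z2; rewrite /gamma.
  under eq_bigr do rewrite !ffunE /GRing.scale/= mulrDl -mulrA.
  by rewrite big_split -mulr_sumr !ffunE /GRing.scale/=; ring.
have [|u u0 uE] := @farkas R V _ (index_enum _) alpha gamma (index_enum_uniq _)
    alphaP gammaP.
  move=> z h; rewrite subr_le0.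
  apply: (dual _ (fun u => z (Some (inr u)))) => /=.
    by have := h None (mem_index_enum _); rewrite /= oppr_le0.
  move=> x v; have := h (Some (x, v)) (mem_index_enum _) => /=; lra.
have sumE (z : V) : gamma z = \sum_x \sum_v u (Some (x, v)) *
    (z (Some (inl x)) - z None * c x v - z (Some (inr v)) * d x v)
    - u None * z None.
  rewrite uE (bigD1 None)//= mulrN addrC; congr (_ - _).
  rewrite (reindex_omap Some id) => [|[]//]; rewrite pair_big/=.
  by apply: eq_big => [[x v]|[x v] _]; rewrite ?eqxx.
(* Comparing coefficients on basis vectors reads off the primal: [inl] gives the marginals, [inr]
   the side constraints, and [None] the cost bound, whose slack is the multiplier [u None]. *)
have delta k : gamma [ffun j => (j == k)%:R] = _ := sumE _.
exists (fun x v => u (Some (x, v))); split => //.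
- move=> x; have := delta (Some (inl x)); rewrite /gamma !ffunE/=.
  rewrite (bigD1 x)//= [X in _ + X - _]big1 ?ffunE ?eqxx; last first.
    by move=> y /negbTE yx; rewrite ffunE (inj_eq Some_inj) (inj_eq inl_inj) yx
      mul0r.
  rewrite (bigD1 x)//= [X in _ = _ + X - _]big1; last first.
    move=> y /negbTE yx; rewrite big1// => v _.
    by rewrite !ffunE (inj_eq Some_inj) (inj_eq inl_inj) yx/=; ring.
  move=> h; transitivity (1 * p x + 0 - 0 * B); last by ring.
  rewrite h !mulr0 subr0 addr0; apply: eq_bigr => v _.
  by rewrite !ffunE eqxx/=; ring.
- move=> v; have := delta (Some (inr v)); rewrite /gamma !ffunE/=.
  rewrite big1; last by move=> y _; rewrite ffunE/= mul0r.
  move=> h; apply/eqP; rewrite -oppr_eq0 -sumrN; apply/eqP.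
  transitivity (0 - 0 * B : R); last by ring.
  rewrite h mulr0 subr0; apply: eq_bigr => x _.
  rewrite (bigD1 v)//= big1 ?addr0; last first.
    move=> w /negbTE wv; rewrite !ffunE/= (inj_eq Some_inj) (inj_eq inr_inj) wv.
    by rewrite /=; ring.
  by rewrite !ffunE eqxx/=; ring.
- have := delta None; rewrite /gamma !ffunE/=.
  rewrite big1; last by move=> y _; rewrite ffunE/= mul0r.
  under [X in _ = X - _]eq_bigr do under eq_bigr do
    rewrite !ffunE/= sub0r mul1r mul0r subr0 mulrN.
  under [X in _ = X - _]eq_bigr do rewrite sumrN.
  by rewrite sumrN; have := u0 None; lra.
Qed.

(** * Bounded measurable functions *)

(** Both conditions are relative to [D], since residuals and test functions are controlled on the
    support only. Under a probability they give integrability, and they are stable under the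
    algebraic operations used below. *)
Definition bounded_measurable {d} {T : measurableType d} {R : realType}
    (D : set T) (f : T -> R) :=
  measurable_fun D f /\ exists M, forall x, D x -> `|f x| <= M.

Lemma measurable_fun_natr {R : realType} :
  measurable_fun setT (fun b : bool => b%:R : R).
Proof. by []. Qed.

Section bounded_measurable.
Context {d} {T : measurableType d} {R : realType}.
Implicit Types (D : set T) (f g : T -> R) (P : probability T R).

Lemma bounded_measurable_integrable P D f :
  measurable D -> bounded_measurable D f -> P.-integrable D (EFin \o f).
Proof.
move=> mD [mf [M fM]]; apply: measurable_bounded_integrable => //.
  by rewrite (le_lt_trans (probability_le1 P mD))// ltry.
exists M; split; [exact: num_real|move=> N MN x Dx].
by rewrite /= (le_trans (fM _ Dx))// ltW.
Qed.

Lemma bounded_measurable_cst D (c : R) : bounded_measurable D (fun=> c).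
Proof. by split; [exact: measurable_cst|exists `|c|]. Qed.

Lemma bounded_measurableD D f g : bounded_measurable D f ->
  bounded_measurable D g -> bounded_measurable D (fun x => f x + g x).
Proof.
move=> [mf [M fM]] [mg [N gN]]; split; first exact: measurable_funD.
by exists (M + N) => x Dx; rewrite (le_trans (ler_normD _ _))// lerD// ?fM ?gN.
Qed.

Lemma bounded_measurableM D f g : bounded_measurable D f ->
  bounded_measurable D g -> bounded_measurable D (fun x => f x * g x).
Proof.
move=> [mf [M fM]] [mg [N gN]]; split; first exact: measurable_funM.
by exists (M * N) => x Dx; rewrite normrM ler_pM ?fM ?gN.
Qed.

Lemma bounded_measurableB D f g : bounded_measurable D f ->
  bounded_measurable D g -> bounded_measurable D (fun x => f x - g x).
Proof.
move=> bf bg; rewrite (_ : (fun _ => _) = (fun x => f x + (-1) * g x)).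
  by apply: bounded_measurableD => //; apply: bounded_measurableM => //;
    exact: bounded_measurable_cst.
by apply/funext => x; rewrite mulN1r.
Qed.

Lemma bounded_measurable_norm D f :
  bounded_measurable D f -> bounded_measurable D (fun x => `|f x|).
Proof.
move=> [mf [M fM]]; split; first exact: measurableT_comp mf.
by exists M => x Dx; rewrite normr_id fM.
Qed.

Lemma bounded_measurable_indic D A :
  measurable A -> bounded_measurable D (\1_A : T -> R).
Proof.
move=> mA; split; first exact: measurable_indic.
by exists 1 => x _; rewrite indicE; case: (_ \in _); rewrite ?normr1 ?normr0.
Qed.

Lemma bounded_measurable_bool D (b : T -> bool) :
  measurable_fun setT b -> bounded_measurable D (fun x => (b x)%:R : R).
Proof.
move=> mb; split.
  exact/measurable_funTS/(measurableT_comp measurable_fun_natr mb).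
by exists 1 => x _; case: (b x); rewrite ?normr1 ?normr0.
Qed.

Lemma bounded_measurable_sum (I : Type) (s : seq I) D (f : I -> T -> R) :
  (forall i, bounded_measurable D (f i)) ->
  bounded_measurable D (fun x => \sum_(i <- s) f i x).
Proof.
move=> bf; elim: s => [|i s IH].
  rewrite (_ : (fun _ => _) = fun=> 0); first exact: bounded_measurable_cst.
  by apply/funext => x; rewrite big_nil.
rewrite (_ : (fun _ => _) = (fun x => f i x + \sum_(j <- s) f j x)).
  exact: bounded_measurableD.
by apply/funext => x; rewrite big_cons.
Qed.

Lemma bounded_measurable_comp {d'} {T' : measurableType d'} (D : set T)
    (D' : set T') (phi : T' -> T) f :
  measurable D -> measurable_fun setT phi -> (forall x, D' x -> D (phi x)) ->
  bounded_measurable D f -> bounded_measurable D' (f \o phi).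
Proof.
move=> mD mphi DD' [mf [M fM]]; split; last by exists M => x /DD'; exact: fM.
apply: (measurable_comp mD) => //; first by move=> _ [x D'x <-]; exact: DD'.
exact: measurable_funTS.
Qed.

Lemma bounded_measurable_restrict D f : measurable D ->
  bounded_measurable D f -> bounded_measurable setT (f \_ D).
Proof.
move=> mD [mf [M fM]]; split; first exact/(measurable_restrictT _ mD).
exists `|M| => x _; rewrite patchE; case: ifPn; last by rewrite normr0.
by rewrite inE => /fM fxM; rewrite (le_trans fxM)// ler_norm.
Qed.

Lemma Rintegral_sum (I : Type) (s : seq I) P D (f : I -> T -> R) :
  measurable D -> (forall i, bounded_measurable D (f i)) ->
  \int[P]_(x in D) (\sum_(i <- s) f i x) = \sum_(i <- s) \int[P]_(x in D) f i x.
Proof.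
move=> mD bf; elim: s => [|i s IH].
  rewrite big_nil; under eq_Rintegral do rewrite big_nil.
  by rewrite Rintegral_cst// mul0r.
rewrite big_cons -IH; under eq_Rintegral do rewrite big_cons.
by rewrite RintegralD//; apply: bounded_measurable_integrable => //;
  exact: bounded_measurable_sum.
Qed.

Lemma Rintegral_full P D f : measurable D -> P D = 1%E ->
  bounded_measurable setT f -> \int[P]_x f x = \int[P]_(x in D) f x.
Proof.
move=> mD PD1 bf; rewrite /Rintegral (negligible_integral (measurableC mD))//.
- by rewrite setDE setCK setTI.
- exact: bounded_measurable_integrable.
- by rewrite /= probability_setC// PD1 subee.
Qed.

Lemma normr_Rintegral_le P D f M : measurable D -> bounded_measurable D f ->
  0 <= M -> (forall x, D x -> `|f x| <= M) -> `|\int[P]_(x in D) f x| <= M.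
Proof.
move=> mD bf M0 fM.
rewrite (le_trans (le_normr_Rintegral _ _))//.
  exact: bounded_measurable_integrable.
rewrite (@le_trans _ _ (\int[P]_(x in D) M))//.
  apply: le_Rintegral => //; apply: bounded_measurable_integrable => //.
    exact: bounded_measurable_norm.
  exact: bounded_measurable_cst.
rewrite Rintegral_cst// ler_piMr// -lee_fin fineK ?probability_le1//.
exact: fin_num_measure.
Qed.

End bounded_measurable.

Lemma Rintegral_distribution {d d'} {T : measurableType d}
    {T' : measurableType d'} {R : realType} (P : probability T R)
    (X : {mfun T >-> T'}) (f : T' -> R) : bounded_measurable setT f ->
  \int[distribution P X]_y f y = \int[P]_x f (X x).
Proof.
move=> bf; rewrite /Rintegral integral_distribution//.
  by apply/measurable_EFinP; case: bf.
apply: (@bounded_measurable_integrable _ _ _ _ _ (f \o X)) => //.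
exact: (@bounded_measurable_comp _ _ _ _ _ setT).
Qed.

(** * Fubini for bounded functions on a product of two probability spaces *)

Section Rintegral_product.
Context {d1 d2} {T1 : measurableType d1} {T2 : measurableType d2}.
Context {R : realType} (P1 : probability T1 R) (P2 : probability T2 R).
Variable f : T1 * T2 -> R.
Hypothesis bf : bounded_measurable setT f.

Let f_integrable : (P1 \x P2)%E.-integrable setT (EFin \o f).
Proof.
case: (bf) => mf [M fM]; apply/integrable12ltyP; first exact/measurable_EFinP.
apply: (@le_lt_trans _ _ (\int[P1]_x M%:E)%E); last first.
  by rewrite integral_cst//= probability_setT mule1 ltry.
have mx x : measurable_fun setT (fun y => f (x, y)).
  exact: measurableT_comp mf (measurable_pair1 _).
apply: ge0_le_integral => //=.
- by move=> x _; exact: integral_ge0.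
- apply: (measurable_fun_fubini_tonelli_F (abse \o (EFin \o f))) => //=.
  by apply: measurableT_comp => //; exact/measurable_EFinP.
- move=> x _; apply: (@le_trans _ _ (\int[P2]_y M%:E)%E).
    apply: ge0_le_integral => //=.
    + exact/measurable_EFinP/(measurableT_comp _ (mx x)).
    + by move=> y _; rewrite lee_fin; exact: fM.
  by rewrite integral_cst//= probability_setT mule1.
Qed.

Let sections1 x : bounded_measurable setT (fun y => f (x, y)).
Proof.
exact: (bounded_measurable_comp measurableT (measurable_pair1 x) (fun _ _ => I) bf).
Qed.

Let sections2 y : bounded_measurable setT (fun x => f (x, y)).
Proof.
exact: (bounded_measurable_comp measurableT (measurable_pair2 y) (fun _ _ => I) bf).
Qed.

Lemma Rintegral_Fubini :
  \int[P1]_x \int[P2]_y f (x, y) = \int[P2]_y \int[P1]_x f (x, y).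
Proof.
rewrite /Rintegral; congr fine.
transitivity (\int[P1]_x \int[P2]_y (f (x, y))%:E)%E.
  apply: eq_integral => x _; rewrite fineK//; apply: integrable_fin_num => //.
  exact: (bounded_measurable_integrable P2 measurableT (sections1 x)).
rewrite (Fubini f_integrable); apply: eq_integral => y _.
rewrite fineK//; apply: integrable_fin_num => //.
exact: (bounded_measurable_integrable P1 measurableT (sections2 y)).
Qed.

Lemma bounded_measurable_Rintegral :
  bounded_measurable setT (fun y => \int[P1]_x f (x, y)).
Proof.
split.
  exact: measurableT_comp (measurable_fubini_G f_integrable).
case: (bf) => _ [M fM]; exists `|M| => y _.
apply: (normr_Rintegral_le _ measurableT (sections2 y)) => // x _.
by rewrite (le_trans (fM _ _))// ler_norm.
Qed.

End Rintegral_product.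

(** * Expectations on pairs *)

Section pairs.
Context {R : realType}.
Implicit Types (K J : probability (R * bool)%type R) (f : R * bool -> R).

Lemma measurable_pairs : measurable (@pairs R).
Proof. exact: measurableX. Qed.

Lemma measurable_triples : measurable (@triples R).
Proof. by apply: measurableX => //; exact: measurableX. Qed.

Lemma measurable_residual :
  measurable_fun setT (fun z : R * bool => z.1 - z.2%:R).
Proof.
apply: measurable_funB => //.
exact: (measurableT_comp measurable_fun_natr measurable_snd).
Qed.

Lemma residual_le1 (z : R * bool) : pairs z -> `|z.1 - z.2%:R| <= 1.
Proof.
case=> /=; rewrite in_itv/= => /andP[z0 z1] _; rewrite ler_norml.
by case: z.2 => /=; lra.
Qed.

Lemma bounded_measurable_residual :
  bounded_measurable pairs (fun z : R * bool => z.1 - z.2%:R).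
Proof.
split; first exact: measurable_funTS measurable_residual.
by exists 1; exact: residual_le1.
Qed.

Lemma bounded_measurable_fst (h : R -> R) :
  bounded_measurable (`[0, 1]%classic : set R) h ->
  bounded_measurable pairs (h \o fst).
Proof. by apply: bounded_measurable_comp => // z []. Qed.

Lemma bounded_measurable_residualM (h : R -> R) :
  bounded_measurable (`[0, 1]%classic : set R) h ->
  bounded_measurable pairs (fun z : R * bool => (z.1 - z.2%:R) * h z.1).
Proof.
move=> /bounded_measurable_fst; apply: bounded_measurableM.
exact: bounded_measurable_residual.
Qed.

Lemma calibratedP K : K pairs = 1%E -> calibrated K <->
  forall A : set R, measurable A ->
    \int[K]_(z in pairs) ((z.1 - z.2%:R) * \1_A z.1) = 0.
Proof.
move=> K1.
have Kae (P : R * bool -> Prop) :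
    (forall z, pairs z -> P z) -> {ae K, forall z, P z}.
  move=> HP; exists (~` pairs); split; first exact: measurableC measurable_pairs.
    by rewrite /= probability_setC ?K1 ?subee//; exact: measurable_pairs.
  by move=> z nPz zp; apply: nPz; exact: HP.
have bmA A : measurable A -> bounded_measurable pairs
    (fun z : R * bool => (z.1 - z.2%:R) * \1_A z.1).
  by move=> mA; apply: bounded_measurable_residualM; exact: bounded_measurable_indic.
have iy : K.-integrable setT (EFin \o (fun z : R * bool => z.2%:R)).
  apply: bounded_measurable_integrable => //.
  by apply: bounded_measurable_bool; exact: measurable_snd.
split=> [[g [[mg ig gE] gid]] A mA|KA].
  have mXA : measurable (fst @^-1` A : set (R * bool)).
    by rewrite -[_ @^-1` _]setTI; exact: measurable_fst.
  have : \int[K]_(z in fst @^-1` A) (g z.1 - z.2%:R) = 0.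
    rewrite RintegralB//; first by apply/eqP; rewrite subr_eq0 /Rintegral gE.
      exact: integrableS ig.
    exact: integrableS iy.
  rewrite Rintegral_mkcond [in X in _ -> X]Rintegral_mkcond => gy0; rewrite -gy0.
  rewrite /Rintegral; congr fine; apply: ae_eq_integral => //.
  - apply/measurable_EFinP; apply/(measurable_restrictT _ measurable_pairs).
    by case: (bmA _ mA).
  - apply/measurable_EFinP; apply/(measurable_restrictT _ mXA).
    apply: measurable_funTS; apply: measurable_funB.
      exact: measurableT_comp mg _.
    exact: (measurableT_comp measurable_fun_natr measurable_snd).
  - have := Kae _ (fun z => id); apply: filterS2 gid => z gz zp _.
    rewrite /= !patchE mem_set// indicE -[z \in fst @^-1` A]/(z.1 \in A).
    by case: ifP => _; rewrite ?gz ?mulr1 ?mulr0.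
(* The version is the identity cut off to 0 outside [[0, 1]]: it is bounded, hence integrable on the
   whole space, and still equals the prediction almost surely. *)
pose id01 : R -> R := (id : R -> R) \_ (`[0, 1]%classic : set R).
exists id01; split; last first.
  apply: Kae => z [z1 _]; rewrite /id01 patchE mem_set//.
have bid : bounded_measurable setT id01.
  apply: bounded_measurable_restrict => //; split => //.
  exists 1 => x; rewrite /= in_itv/= => /andP[x0 x1].
  by rewrite ger0_norm.
have bidf : bounded_measurable setT (id01 \o fst : R * bool -> R).
  exact: (bounded_measurable_comp measurableT).
have iid : K.-integrable setT (EFin \o (id01 \o fst)).
  exact: bounded_measurable_integrable.
split => //; first by case: bid.
move=> A mA.
have mXA : measurable (fst @^-1` A : set (R * bool)).
  by rewrite -[_ @^-1` _]setTI; exact: measurable_fst.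
have iidA := integrableS measurableT mXA (@subsetT _ _) iid.
have iyA := integrableS measurableT mXA (@subsetT _ _) iy.
have : \int[K]_(z in fst @^-1` A) (id01 z.1 - z.2%:R) = 0.
  rewrite -(KA A mA) Rintegral_mkcond [in RHS]Rintegral_mkcond.
  rewrite /Rintegral; congr fine; apply: ae_eq_integral => //.
  - apply/measurable_EFinP; apply/(measurable_restrictT _ mXA).
    apply: measurable_funTS; apply: measurable_funB; first by case: bidf.
    exact: (measurableT_comp measurable_fun_natr measurable_snd).
  - apply/measurable_EFinP; apply/(measurable_restrictT _ measurable_pairs).
    by case: (bmA _ mA).
  - apply: Kae => z zp _; rewrite /= /id01 !patchE (mem_set zp) indicE.
    rewrite -[z \in fst @^-1` A]/(z.1 \in A) (mem_set zp.1).
    by case: ifP => _; rewrite ?mulr1 ?mulr0.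
rewrite RintegralB// => /eqP; rewrite subr_eq0 => /eqP h.
have fE (f : R * bool -> R) : K.-integrable (fst @^-1` A) (EFin \o f) ->
    (\int[K]_(z in fst @^-1` A) (f z)%:E = (\int[K]_(z in fst @^-1` A) f z)%:E)%E.
  by move=> fi; rewrite /Rintegral fineK ?integrable_fin_num.
by rewrite (fE (fun z => id01 z.1))// (fE (fun z => z.2%:R))// h.
Qed.

End pairs.

(** * Image measures, uniform thresholds, and the bins as functions of the threshold *)

Section transfer.
Context {R : realType}.

Lemma Rintegral_indicl {d} {T : measurableType d} (P : probability T R)
    (D : set T) (f : T -> R) :
  \int[P]_(x in D) f x = \int[P]_x (\1_D x * f x).
Proof.
rewrite Rintegral_mkcond; congr Rintegral; apply/funext => x.
by rewrite patchE indicE; case: ifP => _; rewrite ?mul1r ?mul0r.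
Qed.

Lemma Rintegral_distribution_pairs {d} {T : measurableType d}
    (P : probability T R) (X : {mfun T >-> (R * bool)%type}) (D : set T)
    (f : R * bool -> R) :
  measurable D -> P D = 1%E -> (forall x, D x -> pairs (X x)) ->
  bounded_measurable pairs f ->
  \int[distribution P X]_(z in pairs) f z = \int[P]_(x in D) f (X x).
Proof.
move=> mD PD1 DX bf; rewrite Rintegral_mkcond.
have bfp := bounded_measurable_restrict measurable_pairs bf.
rewrite Rintegral_distribution// (Rintegral_full mD PD1); last first.
  exact: (bounded_measurable_comp measurableT _ _ bfp).
by apply: eq_Rintegral => x; rewrite inE => /DX Xx; rewrite patchE mem_set.
Qed.

Lemma uniform_prob_itv (a b : R) : 0 <= a -> a <= b -> b <= 1 ->
  fine (uniform_prob (@ltr01 R) `]a, b]) = b - a.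
Proof.
move=> a0 ab b1; rewrite /uniform_prob.
rewrite (eq_integral (cst 1%E)); last first.
  move=> x; rewrite inE/= in_itv/= => /andP[ax xb].
  by rewrite /uniform_pdf (ltW (le_lt_trans a0 ax)) (le_trans xb b1)/= subr0 invr1.
rewrite integral_cst//= mul1e lebesgue_measure_itv/= lte_fin.
by case: ltgtP ab => //= -> _; rewrite subrr.
Qed.

Lemma bin_ltE (J : probability (R * bool)%type R) q :
  bin_lt J q =
  \int[J]_(z in pairs) ((z.1 - z.2%:R) * \1_(`]-oo, q[%classic : set R) z.1).
Proof.
apply: eq_Rintegral => z _; rewrite indicE; congr (_ * (nat_of_bool _)%:R).
by apply/idP/idP; rewrite inE/= in_itv.
Qed.

Lemma bin_geE (J : probability (R * bool)%type R) q :
  bin_ge J q =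
  \int[J]_(z in pairs) ((z.1 - z.2%:R) * \1_(`[q, +oo[%classic : set R) z.1).
Proof.
apply: eq_Rintegral => z _; rewrite indicE; congr (_ * (nat_of_bool _)%:R).
by apply/idP/idP; rewrite inE/= in_itv/= andbT.
Qed.

(** The bin is a partial integral of a bounded function that is jointly measurable in the pair and
    the threshold, so measurability in [q] comes with Fubini. *)
Lemma bounded_measurable_bin (J : probability (R * bool)%type R)
    (b : R -> R -> bool) :
  measurable_fun setT (fun vq : R * R => b vq.1 vq.2) ->
  bounded_measurable setT
    (fun q : R => \int[J]_(z in pairs) ((z.1 - z.2%:R) * (b z.1 q)%:R)).
Proof.
move=> mb.
rewrite (_ : (fun _ => _) = (fun q => \int[J]_z
    (\1_pairs z * ((z.1 - z.2%:R) * (b z.1 q)%:R)))); last first.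
  by apply/funext => q; rewrite Rintegral_indicl.
pose f (x : (R * bool) * R) :=
  \1_pairs x.1 * ((x.1.1 - x.1.2%:R) * (b x.1.1 x.2)%:R).
apply: (@bounded_measurable_Rintegral _ _ _ _ _ J (uniform_prob (@ltr01 R)) f).
rewrite (_ : f = fun x => ((fun z => z.1 - z.2%:R) \_ pairs) x.1 * (b x.1.1 x.2)%:R).
  apply: bounded_measurableM; last first.
    apply: bounded_measurable_bool.
    have := @measurable_fun_pair _ _ _ _ _ _ (fun x : (R * bool) * R => x.1.1) snd.
    move=> h; apply: (measurableT_comp mb (h _ _)) => //.
    exact: measurableT_comp.
  apply: (bounded_measurable_comp measurableT measurable_fst) => //.
  apply: bounded_measurable_restrict; first exact: measurable_pairs.
  exact: bounded_measurable_residual.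
apply/funext => x; rewrite /f patchE indicE mulrA.
by case: ifP => _; rewrite ?mul1r ?mul0r.
Qed.

Lemma bounded_measurable_bin_lt (J : probability (R * bool)%type R) :
  bounded_measurable setT (bin_lt J).
Proof.
apply: (bounded_measurable_bin J (b := fun v q => v < q)).
exact: measurable_fun_ltr.
Qed.

Lemma bounded_measurable_bin_ge (J : probability (R * bool)%type R) :
  bounded_measurable setT (bin_ge J).
Proof.
apply: (bounded_measurable_bin J (b := fun v q => q <= v)).
exact: measurable_fun_ler.
Qed.

End transfer.

(** * Lower bound on the distance to calibration *)

Lemma distribution_full {d d'} {T : measurableType d} {T' : measurableType d'}
    {R : realType} (P : probability T R) (X : {mfun T >-> T'}) (D : set T)
    (B : set T') : measurable D -> measurable B -> P D = 1%E ->
  (forall x, D x -> B (X x)) -> distribution P X B = 1%E.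
Proof.
move=> mD mB PD1 DB; apply/eqP; rewrite eq_le probability_le1//=.
rewrite -PD1 le_measure// inE// -[X in measurable X]setTI.
exact: (measurable_funPT X).
Qed.

Section coupling.
Context {R : realType} (J : probability (R * bool)%type R).
Variable Pi : probability (R * R * bool)%type R.
Hypothesis Pi_coupling : calibrated_couplings J Pi.
Local Notation U := (uniform_prob (@ltr01 R)).

Let Pi1 : Pi triples = 1%E. Proof. by case: Pi_coupling. Qed.

Lemma integral_proj_vy f : bounded_measurable pairs f ->
  \int[J]_(z in pairs) f z = \int[Pi]_(z in triples) f (z.1.2, z.2).
Proof.
move=> bf.
rewrite -(Rintegral_distribution_pairs (X := proj_vy) measurable_triples)//.
  case: Pi_coupling => _ JE _.
  rewrite /Rintegral; congr fine; apply: eq_measure_integral => A mA _.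
  by apply/esym; exact: JE.
by move=> z [] [].
Qed.

Lemma integral_proj_uy f : bounded_measurable pairs f ->
  \int[distribution Pi proj_uy]_(z in pairs) f z =
  \int[Pi]_(z in triples) f (z.1.1, z.2).
Proof.
move=> bf.
rewrite -(Rintegral_distribution_pairs (X := proj_uy) measurable_triples)//.
by move=> z [] [].
Qed.

Let bounded_measurable_u :
  bounded_measurable triples (fun z : R * R * bool => z.1.1).
Proof.
split.
  exact: measurable_funTS (measurableT_comp measurable_fst measurable_fst).
exists 1 => -[[u v] y] [] [] /=; rewrite in_itv/= => /andP[u0 u1] _ _.
by rewrite ger0_norm.
Qed.

Let bounded_measurable_v :
  bounded_measurable triples (fun z : R * R * bool => z.1.2).
Proof.
split.
  exact: measurable_funTS (measurableT_comp measurable_snd measurable_fst).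
exists 1 => -[[u v] y] [] [] /= _; rewrite in_itv/= => /andP[v0 v1] _.
by rewrite ger0_norm.
Qed.

Let bounded_measurable_y :
  bounded_measurable triples (fun z : R * R * bool => z.2%:R : R).
Proof. exact: bounded_measurable_bool measurable_snd. Qed.

Let Ku : distribution Pi proj_uy pairs = 1%E.
Proof.
apply: distribution_full measurable_triples measurable_pairs Pi1 _.
by move=> z [] [].
Qed.

(** Calibration of [(u, y)] allows subtracting [(u - y) * \1_A u], of mean 0. The displacement keeps
    its weight [\1_A z.1.2], so that two complementary bins charge it once in total and not
    twice. *)
Lemma bin_le_coupling (A : set R) : measurable A ->
  `|\int[J]_(z in pairs) ((z.1 - z.2%:R) * \1_A z.1)| <=
  \int[Pi]_(z in triples)
    (`|z.1.1 - z.1.2| * \1_A z.1.2 + `|\1_A z.1.2 - \1_A z.1.1|).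
Proof.
move=> mA.
have bA : bounded_measurable (`[0, 1]%classic : set R) (\1_A : R -> R).
  exact: bounded_measurable_indic.
have bAv : bounded_measurable triples (fun z : R * R * bool => \1_A z.1.2 : R).
  apply: (bounded_measurable_comp _ _ _ bA) => //; last by move=> z [] [].
  exact: measurableT_comp.
have bAu : bounded_measurable triples (fun z : R * R * bool => \1_A z.1.1 : R).
  apply: (bounded_measurable_comp _ _ _ bA) => //; last by move=> z [] [].
  exact: measurableT_comp.
rewrite integral_proj_vy; last exact: bounded_measurable_residualM.
have := (calibratedP Ku).1 (let: And3 _ _ c := Pi_coupling in c) A mA.
rewrite integral_proj_uy; last exact: bounded_measurable_residualM.
move=> cal0.
rewrite -[X in `|X|]subr0 -[X in _ - X]cal0 -RintegralB//=; last 3 first.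
- exact: measurable_triples.
- apply: bounded_measurable_integrable; first exact: measurable_triples.
  by apply: bounded_measurableM => //; exact: bounded_measurableB.
- apply: bounded_measurable_integrable; first exact: measurable_triples.
  by apply: bounded_measurableM => //; exact: bounded_measurableB.
apply: (le_trans (le_normr_Rintegral _ _)).
- exact: measurable_triples.
- apply: bounded_measurable_integrable; first exact: measurable_triples.
  by apply: bounded_measurableB; apply: bounded_measurableM => //;
    exact: bounded_measurableB.
apply: le_Rintegral.
- exact: measurable_triples.
- apply: bounded_measurable_integrable; first exact: measurable_triples.
  by apply/bounded_measurable_norm/bounded_measurableB;
    apply: bounded_measurableM => //; exact: bounded_measurableB.
- apply: bounded_measurable_integrable; first exact: measurable_triples.
  apply: bounded_measurableD; last first.
    exact/bounded_measurable_norm/bounded_measurableB.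
  apply: bounded_measurableM => //.
  exact/bounded_measurable_norm/bounded_measurableB.
move=> [[u v] y] [[/= u01 _] _].
have -> : (v - y%:R) * \1_A v - (u - y%:R) * \1_A u =
  (v - u) * \1_A v + (u - y%:R) * (\1_A v - \1_A u) by ring.
rewrite (le_trans (ler_normD _ _))// !normrM lerD//.
  by rewrite distrC (ger0_norm (_ : 0 <= \1_A v)).
rewrite ler_piMl//; exact: (@residual_le1 _ (u, y)).
Qed.

(** For [u <= v] the indicators differ exactly when [q] lies in []u, v]], an interval inside
    [[0, 1]]. *)
Lemma uniform_threshold (u v : R) : 0 <= u <= 1 -> 0 <= v <= 1 ->
  \int[U]_q `|(v < q)%R%:R - (u < q)%R%:R| = `|u - v|.
Proof.
wlog uv : u v / u <= v => [th|].
  case: (leP u v) => [uv|/ltW vu] hu hv; first exact: th.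
  by rewrite distrC -th//; apply: eq_Rintegral => q _; rewrite distrC.
move=> /andP[u0 u1] /andP[v0 v1].
transitivity (\int[U]_q \1_(`]u, v]%classic : set R) q).
  apply: eq_Rintegral => q _; rewrite indicE mem_setE in_itv/= leNgt.
  by case: (ltP v q) (ltP u q) => vq [] uq //=; rewrite ?subrr ?normr0 ?sub0r
    ?normrN ?normr1 ?subr0 ?normr1//;
    have := le_lt_trans uq (le_lt_trans uv vq); rewrite ltxx.
by rewrite distrC ger0_norm ?subr_ge0// -uniform_prob_itv// /Rintegral
  integral_indic// setIT.
Qed.

Lemma l1_ATB_le_coupling :
  l1_ATB J <= 3 * \int[Pi]_(z in triples) `|z.1.1 - z.1.2|.
Proof.
have mtr := @measurable_triples R.
have bcost : bounded_measurable triples (fun z : R * R * bool => `|z.1.1 - z.1.2|).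
  exact/bounded_measurable_norm/bounded_measurableB.
pose step (x : (R * R * bool) * R) : R :=
  `|(x.1.1.2 < x.2)%R%:R - (x.1.1.1 < x.2)%R%:R|.
have bstep : bounded_measurable setT step.
  apply/bounded_measurable_norm/bounded_measurableB; apply: bounded_measurable_bool;
    apply: measurable_fun_ltr => //; apply: measurableT_comp => //;
    exact: measurableT_comp.
(* For fixed [q] this dominates the sum of the two bounds from [bin_le_coupling]: the weights of the
   displacement add up to 1, and both bins have the same mismatch [step]. Integrating over [q] turns
   [step] into [|u - v|], whence 1 + 2 = 3. *)
pose f (x : (R * R * bool) * R) :=
  \1_triples x.1 * (`|x.1.1.1 - x.1.1.2| + 2 * step x).
have bf : bounded_measurable setT f.
  rewrite (_ : f = fun x => ((fun z => `|z.1.1 - z.1.2|) \_ triples) x.1 +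
      \1_triples x.1 * (2 * step x)); last first.
    apply/funext => x; rewrite /f patchE indicE.
    by case: ifP => _; rewrite ?mul1r// !mul0r addr0.
  apply: bounded_measurableD.
    exact: (bounded_measurable_comp measurableT measurable_fst _
      (bounded_measurable_restrict mtr bcost)).
  apply: bounded_measurableM; last first.
    by apply: bounded_measurableM => //; exact: bounded_measurable_cst.
  apply: (bounded_measurable_comp measurableT measurable_fst) => //.
  exact: (bounded_measurable_indic setT mtr).
rewrite -RintegralZl//; last exact: bounded_measurable_integrable.
rewrite Rintegral_indicl.
have -> : \int[Pi]_z (\1_triples z * (3 * `|z.1.1 - z.1.2|)) =
    \int[U]_q \int[Pi]_z f (z, q).
  rewrite -(Rintegral_Fubini Pi U bf); apply: eq_Rintegral => z _.
  rewrite /f /= indicE; have [ztr|_] := boolP (z \in triples); last first.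
    rewrite mul0r; under eq_Rintegral do rewrite mul0r.
    by rewrite Rintegral_cst// mul0r.
  under eq_Rintegral do rewrite mul1r.
  have bz : bounded_measurable setT (fun q => step (z, q)).
    exact: (bounded_measurable_comp measurableT (measurable_pair1 z) _ bstep).
  have iz := bounded_measurable_integrable U measurableT bz.
  rewrite RintegralD//; first last.
  - apply: bounded_measurable_integrable => //.
    by apply: bounded_measurableM => //; exact: bounded_measurable_cst.
  - by apply: bounded_measurable_integrable => //; exact: bounded_measurable_cst.
  rewrite Rintegral_cst// RintegralZl//.
  have -> : fine (U setT) = 1 by rewrite probability_setT.
  move: ztr; rewrite inE => -[[/=]]; rewrite !in_itv/= => u01 v01 _.
  by rewrite /step /= uniform_threshold//; ring.
apply: le_Rintegral => //.
- apply: bounded_measurable_integrable => //.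
  by apply: bounded_measurableD; apply: bounded_measurable_norm;
    [exact: bounded_measurable_bin_lt|exact: bounded_measurable_bin_ge].
- apply: bounded_measurable_integrable => //.
  exact: (bounded_measurable_Rintegral _ U).
move=> q _; rewrite -(Rintegral_indicl Pi triples (fun z => _ + 2 * step (z, q))).
rewrite bin_ltE bin_geE.
apply: (le_trans (lerD (bin_le_coupling _) (bin_le_coupling _))) => //.
have bA (A : set R) : measurable A -> bounded_measurable triples
    (fun z : R * R * bool =>
       `|z.1.1 - z.1.2| * \1_A z.1.2 + `|\1_A z.1.2 - \1_A z.1.1|).
  move=> mA; have bA : bounded_measurable setT (\1_A : R -> R).
    exact: bounded_measurable_indic.
  apply: bounded_measurableD.
    apply: bounded_measurableM => //.
    apply: (bounded_measurable_comp measurableT _ _ bA) => //.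
    exact: measurableT_comp.
  apply/bounded_measurable_norm/bounded_measurableB;
    apply: (bounded_measurable_comp measurableT _ _ bA) => //;
    exact: measurableT_comp.
rewrite -RintegralD//; last 2 first.
- by apply: bounded_measurable_integrable => //; exact: bA.
- by apply: bounded_measurable_integrable => //; exact: bA.
apply: le_Rintegral => //.
- apply: bounded_measurable_integrable => //.
  by apply: bounded_measurableD; exact: bA.
- apply: bounded_measurable_integrable => //; apply: bounded_measurableD => //.
  apply: bounded_measurableM; first exact: bounded_measurable_cst.
  exact: (bounded_measurable_comp measurableT (measurable_pair2 q) _ bstep).
move=> [[u v] y] _; rewrite /step /= !indicE !mem_setE !in_itv/= !andbT !(leNgt q).
by case: (v < q); case: (u < q); rewrite /= ?subrr ?sub0r ?subr0 ?normrN ?normr0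
  ?normr1; lra.
Qed.

End coupling.

(** * Calibrated couplings from a grid *)

Section finite_mixture.
Context {d d'} {T : measurableType d} {T' : measurableType d'} {R : realType}.
Variables (P : probability T R) (I : finType) (c : I -> R) (S : I -> set T).
Variable psi : I -> {mfun T >-> T'}.
Hypotheses (c0 : forall i, 0 <= c i) (mS : forall i, measurable (S i)).
Hypothesis c1 : \sum_i c i * fine (P (S i)) = 1.

Let image_part i : {measure set T' -> \bar R} :=
  measure_function_pushforward__canonical__measure_function_Measure
    (mrestr P (mS i)) (measurable_funPT (psi i)).

Let component i : {measure set T' -> \bar R} :=
  mscale (NngNum (c0 i)) (image_part i).

Let mu0 : {measure set T' -> \bar R} := mzero.

(** [msum] adds a sequence indexed by naturals, hence the enumeration of [I]; the default [mu0] is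
    never read, as indices stay below [#|I|]. *)
Let mixture : {measure set T' -> \bar R} :=
  msum (nth mu0 [seq component i | i <- enum I]) #|I|.

Let integral_component i (h : T' -> R) M :
  measurable_fun setT h -> (forall x, 0 <= h x <= M) ->
  (\int[component i]_x (h x)%:E = (c i * \int[P]_(x in S i) h (psi i x))%:E)%E.
Proof.
move=> mh hM.
have mhE : measurable_fun setT (EFin \o h) by exact/measurable_EFinP.
have mhp : measurable_fun setT (EFin \o h \o psi i).
  exact: (measurableT_comp mhE).
have bhp D : bounded_measurable D (h \o psi i).
  split; first exact: measurable_funTS (measurableT_comp mh _).
  by exists M => x _; have /andP[? ?] := hM (psi i x); rewrite ger0_norm.
rewrite ge0_integral_mscale//=; last first.
  by move=> x _; rewrite lee_fin; case/andP: (hM x).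
rewrite ge0_integral_pushforward//=; last first.
  by move=> x _; rewrite lee_fin; case/andP: (hM x).
rewrite preimage_setT EFinM; congr (_ * _)%E.
rewrite /Rintegral fineK; last first.
  apply: integrable_fin_num => //.
  exact: (bounded_measurable_integrable P (mS i) (bhp _)).
rewrite [LHS](ge0_negligible_integral (measurableC (mS i)))//=.
- rewrite setDE setCK setTI; apply: eq_measure_integral => A mA AS.
  by have : mrestr P (mS i) A = P A by rewrite /mrestr setIidl.
- by move=> x _; rewrite lee_fin; case/andP: (hM (psi i x)).
- by rewrite /mrestr setICl measure0.
Qed.

Let integral_mixture (h : T' -> R) M :
  measurable_fun setT h -> (forall x, 0 <= h x <= M) ->
  (\int[mixture]_x (h x)%:E =
   (\sum_i c i * \int[P]_(x in S i) h (psi i x))%:E)%E.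
Proof.
move=> mh hM; rewrite ge0_integral_measure_sum//; last 2 first.
- by move=> x _; rewrite lee_fin; case/andP: (hM x).
- exact/measurable_EFinP.
rewrite -sumEFin; under [RHS]eq_bigr do rewrite -(integral_component _ mh hM).
transitivity (\sum_(m <- [seq component i | i <- enum I])
    \int[m]_x (h x)%:E)%E; last by rewrite big_map big_enum.
by rewrite (big_nth mu0) size_map -cardT big_mkord.
Qed.

Let mixture_setT : mixture [set: T'] = 1%E.
Proof.
transitivity (\int[mixture]_x (1 : R)%:E)%E.
  by rewrite integral_cst// mul1e.
rewrite (integral_mixture (M := 1))//; last by move=> _; rewrite ler01 lexx.
congr EFin; rewrite -[RHS]c1; apply: eq_bigr => i _.
by rewrite Rintegral_cst// mul1r.
Qed.

Let mixture_prob : probability T' R :=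
  HB.pack (mixture : set T' -> \bar R) (Measure.on mixture)
    (Measure_isProbability.Build _ _ _ mixture mixture_setT).

Lemma finite_mixture : exists Q : probability T' R, forall h,
  bounded_measurable setT h ->
  \int[Q]_x h x = \sum_i c i * \int[P]_(x in S i) h (psi i x).
Proof.
exists mixture_prob => h [mh [M hM]].
(* Integrals against the mixture are computed for nonnegative functions; adding the bound [M]
   reduces to that case, and total mass 1 lets it be cancelled. *)
have M0 x : 0 <= h x + M <= M + M.
  by have := hM x Logic.I; rewrite ler_norml; lra.
have bh : bounded_measurable setT h by split=> //; exists M.
have bM : bounded_measurable setT (fun _ : T' => M) := bounded_measurable_cst _ _.
have bhi i : bounded_measurable (S i) (h \o psi i).
  exact: (bounded_measurable_comp measurableT).
have : \int[mixture_prob]_x (h x + M) =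
    \sum_i c i * \int[P]_(x in S i) (h (psi i x) + M).
  exact: (congr1 fine (@integral_mixture (fun x => h x + M) _
    (measurable_funD mh (measurable_cst _)) M0)).
rewrite RintegralD//; try exact: bounded_measurable_integrable.
have -> : \int[mixture_prob]_x M = M.
  rewrite Rintegral_cst// -[RHS]mulr1; congr (_ * _).
  exact: (congr1 fine mixture_setT).
have -> : \sum_i c i * \int[P]_(x in S i) (h (psi i x) + M) =
    \sum_i c i * \int[P]_(x in S i) h (psi i x) + M.
  transitivity (\sum_i (c i * \int[P]_(x in S i) h (psi i x) +
      M * (c i * fine (P (S i))))).
    apply: eq_bigr => i _; rewrite RintegralD//.
    - by rewrite Rintegral_cst//; ring.
    - exact: (bounded_measurable_integrable P (mS i) (bhi i)).
    - by apply: bounded_measurable_integrable => //; exact: bounded_measurable_cst.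
  by rewrite big_split/= -mulr_sumr c1 mulr1.
by move=> /addIr.
Qed.

End finite_mixture.

(** * The grid of mesh [1/n] and its cells *)

Section grid.
Context {R : realType} (n : nat).
Hypothesis n0 : (0 < n)%N.
Implicit Types (x : 'I_n.+1 * bool) (z : R * bool).

Definition gridpt (k : 'I_n.+1) : R := k%:R / n%:R.

(** With [k] running from 0 to [n], the cells are half-open and cut with [[0, 1]], so the last one
    contains only [v = 1]. Together, over both states, they partition the pairs. *)
Definition cell x : set (R * bool) :=
  (`[0, 1] `&` `[gridpt x.1, gridpt x.1 + n%:R^-1[)%classic `*` [set x.2].

Let nR : 0 < n%:R :> R. Proof. by rewrite ltr0n. Qed.

Let gridptS k : gridpt k + n%:R^-1 = k.+1%:R / n%:R.
Proof. by rewrite /gridpt -[X in _ + X]mul1r -mulrDl natr1. Qed.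

Lemma measurable_cell x : measurable (cell x).
Proof. by apply: measurableX => //; exact: measurableI. Qed.

Lemma gridpt_itv k : 0 <= gridpt k <= 1.
Proof.
rewrite /gridpt divr_ge0//= ler_pdivrMr// mul1r ler_nat.
by rewrite -ltnS ltn_ord.
Qed.

Lemma cell_dist x z : cell x z -> `|z.1 - gridpt x.1| <= n%:R^-1.
Proof.
by move=> [[/= _]]; rewrite in_itv/= => /andP[a b] _; rewrite ler_norml; lra.
Qed.

Lemma sub_cell_pairs x : cell x `<=` pairs.
Proof. by move=> z [[/= z01 _] _]. Qed.

(** The only cell through a pair [z] has index the integer part of [n * z.1], which is at most [n]
    because [z.1 <= 1]. *)
Lemma sum_cell z : \sum_x \1_(cell x) z = \1_pairs z :> R.
Proof.
rewrite [RHS]indicE; have [|zp] := boolP (z \in pairs); last first.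
  rewrite big1// => x _; rewrite indicE memNset//.
  by move=> /sub_cell_pairs zp'; rewrite mem_set in zp.
rewrite inE => -[/=]; rewrite in_itv/= => /andP[z0 z1] _.
have nz0 : 0 <= n%:R * z.1 by rewrite mulr_ge0.
have /andP[kz zk] := truncn_itv nz0.
have kn : (Num.truncn (n%:R * z.1) < n.+1)%N.
  rewrite ltnS -(ler_nat R) (le_trans kz)// -[leRHS]mulr1 ler_wpM2l//.
pose k : 'I_n.+1 := Ordinal kn.
rewrite (bigD1 (k, z.2))//= big1 ?addr0.
  rewrite indicE mem_set//; split => //=; split; rewrite /= in_itv/= ?z0//.
  rewrite gridptS /gridpt.
  by rewrite ler_pdivrMr// ltr_pdivlMr// mulrC kz.
move=> -[k' y]; rewrite xpair_eqE negb_and => ky.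
rewrite indicE memNset// => -[[/= _]]; rewrite in_itv/= => /andP[a b] /= yz.
move: ky; rewrite yz eqxx orbF => /eqP; apply.
apply/val_inj => /=; apply/esym/truncn_def.
move: a b; rewrite gridptS /gridpt.
by rewrite ler_pdivrMr// ltr_pdivlMr// mulrC => -> ->.
Qed.

Lemma Rintegral_cells (P : probability (R * bool)%type R) f :
  bounded_measurable pairs f ->
  \int[P]_(z in pairs) f z = \sum_x \int[P]_(z in cell x) f z.
Proof.
move=> bf.
under eq_bigr => x _ do rewrite -(setIidr (@sub_cell_pairs x)) Rintegral_mkcondr.
rewrite -Rintegral_sum.
- apply: eq_Rintegral => z zp.
  transitivity (\sum_x \1_(cell x) z * f z).
    by rewrite -mulr_suml sum_cell indicE zp mul1r.
  apply: eq_bigr => x _; rewrite patchE indicE.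
  by case: ifP => _; rewrite ?mul1r ?mul0r.
- exact: measurable_pairs.
- move=> x; rewrite (_ : f \_ (cell x) = fun z => f z * \1_(cell x) z).
    apply: bounded_measurableM => //; apply: bounded_measurable_indic.
    exact: measurable_cell.
  apply/funext => z; rewrite patchE indicE.
  by case: ifP => _; rewrite ?mulr1 ?mulr0.
Qed.

End grid.

(** * Clipping and the test functions of [smCal] *)

Section clip.
Context {R : realType}.
Implicit Types a b x y : R.

Definition clip a b x : R := Num.max a (Num.min b x).

Lemma clip_lipschitz a b x y : `|clip a b x - clip a b y| <= `|x - y|.
Proof.
wlog xy : x y / x <= y => [th|].
  by case: (leP x y) => [|/ltW] xy; [|rewrite distrC (distrC x)]; exact: th.
rewrite distrC (distrC x) !ger0_norm ?subr_ge0//; rewrite /clip.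
  case: (leP b x) => bx; case: (leP b y) => b_y; case: (leP a b) => ab;
    case: (leP a x) => ax; case: (leP a y) => ay; lra.
by rewrite le_max2 ?le_min2.
Qed.

Lemma clip_itv a b x : a <= b -> a <= clip a b x <= b.
Proof.
by rewrite /clip => ab; case: (leP b x); case: (leP a b); case: (leP a x); lra.
Qed.

Lemma clip_id a b x : a <= x <= b -> clip a b x = x.
Proof. by rewrite /clip => /andP[ax xb]; rewrite min_r// max_r. Qed.

Lemma lipschitz_continuous (f : R -> R) :
  (forall x y, `|f x - f y| <= `|x - y|) -> continuous f.
Proof.
move=> fL x; apply/cvgrPdist_le => e e0; near=> y.
rewrite (le_trans (fL _ _))//; near: y.
Unshelve. all: by end_near. Qed.

(** Membership in [W1] says nothing outside [[0, 1]]; precomposing with the clip gives a function on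
    the whole line with the same bounds, to which continuity and smoothing apply. *)
Lemma W1_clip (w : R -> R) : W1 w ->
  (forall x y, `|w (clip 0 1 x) - w (clip 0 1 y)| <= `|x - y|) /\
  forall x, `|w (clip 0 1 x)| <= 1.
Proof.
have c01 x := clip_itv x (@ler01 R).
move=> [wL w1]; split=> [x y|x]; last by rewrite ler_norml w1.
rewrite (le_trans _ (clip_lipschitz 0 1 x y))//.
have := wL (clip 0 1 x, clip 0 1 y); rewrite /= mul1r; apply.
by split; rewrite /= in_itv/= c01.
Qed.

Lemma bounded_measurable_W1 (w : R -> R) : W1 w ->
  bounded_measurable (`[0, 1]%classic : set R) w.
Proof.
move=> /[dup] ww /W1_clip[wL w1]; split; last first.
  by exists 1 => x; rewrite /= in_itv/= => x01; rewrite -(clip_id x01).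
apply: (eq_measurable_fun (w \o clip 0 1)).
  by move=> x; rewrite inE/= in_itv/= => x01; rewrite clip_id.
apply: measurable_funTS; apply: continuous_measurable_fun.
exact: lipschitz_continuous wL.
Qed.

Lemma smCal_ge (J : probability (R * bool)%type R) (w : R -> R) : W1 w ->
  \int[J]_(z in pairs) ((z.1 - z.2%:R) * w z.1) <= smCal J.
Proof.
move=> ww; apply: ub_le_sup; last by exists w.
exists 1 => _ [w' ww' <-]; rewrite (le_trans (ler_norm _))//.
apply: normr_Rintegral_le => //.
- exact: measurable_pairs.
- exact/bounded_measurable_residualM/bounded_measurable_W1.
move=> z zp; rewrite normrM mulr_ile1 ?residual_le1//.
case: zp => /=; rewrite in_itv/= => z01 _.
by have [_ /(_ _ z01)] := ww'; rewrite ler_norml.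
Qed.

Lemma smCal_le (J : probability (R * bool)%type R) (B : R) :
  (forall w, W1 w -> \int[J]_(z in pairs) ((z.1 - z.2%:R) * w z.1) <= B) ->
  smCal J <= B.
Proof.
move=> h; apply: ge_sup => [|_ [w ww <-]]; last exact: h.
eexists; exists (fun=> 0) => //; split=> [z _|v _]; last by lra.
by rewrite /= subrr normr0 mul1r.
Qed.

End clip.

(** * From a dual solution to a Lipschitz potential *)

Section dual.
Context {R : realType} (n : nat).
Hypothesis n0 : (0 < n)%N.
Local Notation t := (@gridpt R n).

(* [W] is the clipped difference [rho v true - rho v false], where
   [rho v y := min_u (|u - v| + s u (y - u))] is 1-Lipschitz in [v]: taking
   [u = v] and [u = y] in the minimum gives the last property. *)
Lemma dual_potential (r : 'I_n.+1 * bool -> R) (s : 'I_n.+1 -> R) :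
  (forall x u, r x <= `|t u - t x.1| + s u * (x.2%:R - t u)) ->
  exists W : R -> R, [/\ forall a b, `|W a - W b| <= 2 * `|a - b|,
    forall a, `|W a| <= 2 & forall x, r x <= (x.2%:R - t x.1) * W (t x.1)].
Proof.
move=> rle.
have t0 : t ord0 = 0 by rewrite /gridpt mul0r.
have t1 : t ord_max = 1 by rewrite /gridpt /= divff// pnatr_eq0 -lt0n.
pose F v (y : bool) u := `|t u - v| + s u * (y%:R - t u).
pose rho v y := F v y [arg min_(u < ord0) F v y u]%O.
have rho_le v y u : rho v y <= F v y u.
  by rewrite /rho; case: arg_minP => // i _ ih; exact: ih.
have rho_ex v y : exists u, rho v y = F v y u by rewrite /rho; eexists.
have rho_lip v v' y : rho v y - rho v' y <= `|v - v'|.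
  have [u ->] := rho_ex v' y; have := rho_le v y u; rewrite /F.
  by have := ler_distD v' (t u) v; rewrite (distrC v'); lra.
pose w v := rho v true - rho v false.
exists (fun v => clip (-2) 2 (w v)); split.
- move=> a b; rewrite (le_trans (clip_lipschitz _ _ _ _))// ler_norml /w.
  have := rho_lip a b true; have := rho_lip a b false.
  have := rho_lip b a true; have := rho_lip b a false; rewrite (distrC b); lra.
- by move=> a; rewrite ler_norml clip_itv//; lra.
move=> [k y].
have /andP[k0 k1] := @gridpt_itv R n n0 k.
have [r0 r1] : r (k, true) <= rho (t k) true /\ r (k, false) <= rho (t k) false.
  by split; rewrite /rho; exact: rle.
have := rho_le (t k) true ord_max; have := rho_le (t k) false ord0.
have := rho_le (t k) true k; have := rho_le (t k) false k.
rewrite /F subrr normr0 t0 t1 sub0r normrN (ger0_norm k0).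
rewrite (ger0_norm (_ : 0 <= 1 - t k)) ?subr_ge0//= => h1 h2 h3 h4.
have t1k : 0 <= 1 - t k by rewrite subr_ge0.
have wk : rho (t k) true = rho (t k) false + w (t k) by rewrite /w; ring.
(* Weighting the two bounds at [u = t k] by [1 - t k] and [t k] eliminates the multiplier [s k]. *)
have s0 : rho (t k) false <= - t k * w (t k).
  by have := ler_wpM2l k0 h2; have := ler_wpM2l t1k h1; rewrite /w; lra.
have s1 : rho (t k) true <= (1 - t k) * w (t k) by rewrite wk; lra.
(* Where the clip acts, one state is covered by the trivial bound at [u = y], [1 - t k] or [t k];
   for the other, clipping only weakens [s0] or [s1]. *)
rewrite /= /clip; case: (leP 2 (w (t k))) => w2.
  rewrite max_r; last by lra.
  have := mulr_ge0 k0 (_ : 0 <= w (t k) - 2); rewrite subr_ge0 => /(_ w2).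
  by case: y => /=; lra.
case: (leP (-2) (w (t k))) => w3; first by case: y => /=; lra.
have := mulr_ge0 t1k (_ : 0 <= - 2 - w (t k)); rewrite subr_ge0 => /(_ (ltW w3)).
by case: y => /=; lra.
Qed.

End dual.

(** * A cheap calibrated plan on the grid *)

Section plan.
Context {R : realType} (J : probability (R * bool)%type R) (n : nat).
Hypotheses (hJ : J pairs = 1%E) (n0 : (0 < n)%N).
Local Notation t := (@gridpt R n).
Local Notation p x := (fine (J (@cell R n x))).

Let nR : 0 < n%:R :> R. Proof. by rewrite ltr0n. Qed.

Let p_ge0 x : 0 <= p x. Proof. exact: fine_ge0. Qed.

Lemma dual_bound (r : 'I_n.+1 * bool -> R) (s : 'I_n.+1 -> R) :
  (forall x u, r x <= `|t u - t x.1| + s u * (x.2%:R - t u)) ->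
  \sum_x r x * p x <= 2 * smCal J + 4 / n%:R.
Proof.
move=> /(dual_potential n0)[W [WL W2 rW]].
(* [W] pairs with [y - v] and test functions with [v - y], whence the sign; halving brings the
   Lipschitz constant and the bound from 2 to 1. *)
pose w v := - W v / 2.
have ww : W1 w.
  split=> [[a b] _|v _] /=; last first.
    rewrite -ler_norml normrM normrN normfV (ger0_norm (_ : 0 <= 2))//.
    by rewrite ler_pdivrMr// mul1r.
  rewrite /w -mulrBl normrM -opprD normrN normfV (ger0_norm (_ : 0 <= 2))//.
  by rewrite ler_pdivrMr// mul1r mulrC WL.
have bw := bounded_measurable_residualM (bounded_measurable_W1 ww).
have bf : bounded_measurable pairs
    (fun z : R * bool => 2 * ((z.1 - z.2%:R) * w z.1) + 4 / n%:R).
  apply: bounded_measurableD; last exact: bounded_measurable_cst.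
  by apply: bounded_measurableM => //; exact: bounded_measurable_cst.
have ifull (f : R * bool -> R) : bounded_measurable pairs f ->
    J.-integrable pairs (EFin \o f).
  by apply: bounded_measurable_integrable; exact: measurable_pairs.
apply: (@le_trans _ _
    (\int[J]_(z in pairs) (2 * ((z.1 - z.2%:R) * w z.1) + 4 / n%:R))).
  rewrite (Rintegral_cells n0)//; apply: ler_sum => x _.
  rewrite -Rintegral_cst; last exact: measurable_cell.
  apply: le_Rintegral.
  - exact: measurable_cell.
  - apply: bounded_measurable_integrable; first exact: measurable_cell.
    exact: bounded_measurable_cst.
  - apply: integrableS (ifull _ bf); [exact: measurable_pairs|
      exact: measurable_cell|exact: sub_cell_pairs].
  move=> z zx; rewrite (le_trans (rW x))//.
  have zd := cell_dist zx; have z2 : z.2 = x.2 by case: zx.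
  have y1 : `|x.2%:R - t x.1| <= 1.
    have := @gridpt_itv R n n0 x.1.
    by rewrite ler_norml; case: x.2 => /=; lra.
  have -> : (x.2%:R - t x.1) * W (t x.1) = 2 * ((z.1 - z.2%:R) * w z.1) +
      ((x.2%:R - t x.1) * (W (t x.1) - W z.1) + (z.1 - t x.1) * W z.1).
    by rewrite /w z2; field.
  rewrite lerD2l (le_trans (ler_norm _))// (le_trans (ler_normD _ _))//.
  (* Moving the argument of [W] costs [2 / n], as [W] is 2-Lipschitz and its factor is at most 1;
     moving the prediction in the residual costs another [2 / n], as [|W| <= 2]. *)
  have -> : 4 / n%:R = 1 * (2 * n%:R^-1) + n%:R^-1 * 2 :> R by ring.
  rewrite !normrM lerD// ler_pM//.
  by rewrite (le_trans (WL _ _))// ler_wpM2l// distrC.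
rewrite RintegralD.
- rewrite Rintegral_cst; last exact: measurable_pairs.
  rewrite (_ : fine _ = 1); last exact: (congr1 fine hJ).
  rewrite mulr1 lerD2r.
  rewrite RintegralZl; last 2 first.
  + exact: measurable_pairs.
  + exact: ifull.
  by rewrite ler_wpM2l// smCal_ge.
- exact: measurable_pairs.
- by apply: ifull; apply: bounded_measurableM => //; exact: bounded_measurable_cst.
- exact/ifull/bounded_measurable_cst.
Qed.

Lemma grid_plan : exists g : 'I_n.+1 * bool -> 'I_n.+1 -> R,
  [/\ forall x u, 0 <= g x u,
    forall x, \sum_u g x u = p x,
    forall u, \sum_x g x u * (x.2%:R - t u) = 0 &
    \sum_x \sum_u g x u * `|t u - t x.1| <= 2 * smCal J + 4 / n%:R].
Proof.
(* For [l = 0], the choice [u = y], an end of the grid, kills the multiplier term and gives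
   [r x <= 0]; in primal terms, moving every pair to its state is calibrated. For [l > 0], dividing
   by [l] reduces to [dual_bound]. *)
apply: transport_duality => r s l; rewrite le_eqVlt => /predU1P[<-|l0] rle.
  rewrite mul0r; apply: sumr_le0 => x _; apply: mulr_le0_ge0 => //.
  have := rle x (if x.2 then ord_max else ord0).
  rewrite mul0r add0r; case: x.2; rewrite /gridpt /=.
    by rewrite divff ?subrr ?mulr0// gt_eqF.
  by rewrite mul0r subrr mulr0.
have -> : \sum_x r x * p x = l * \sum_x (r x / l) * p x.
  by rewrite mulr_sumr; apply: eq_bigr => x _; field; rewrite gt_eqF.
rewrite ler_pM2l//; apply: (dual_bound (s := fun u => s u / l)) => x u.
rewrite ler_pdivrMr//; apply: (le_trans (rle x u)).
by rewrite le_eqVlt; apply/orP; left; apply/eqP; field; rewrite gt_eqF.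
Qed.

End plan.

(** * The coupling induced by a plan on the grid *)

Section coupling_of_plan.
Context {R : realType} (J : probability (R * bool)%type R) (n : nat).
Hypotheses (hJ : J pairs = 1%E) (n0 : (0 < n)%N).
Local Notation t := (@gridpt R n).
Local Notation p x := (fine (J (@cell R n x))).

Definition attach (u : R) (z : R * bool) : R * R * bool := (u, z.1, z.2).

Lemma measurable_attach u : measurable_fun setT (attach u).
Proof. by apply/measurable_fun_pair => //; apply/measurable_fun_pair. Qed.

HB.instance Definition _ u :=
  isMeasurableFun.Build _ _ _ _ (attach u) (measurable_attach u).

Variable g : 'I_n.+1 * bool -> 'I_n.+1 -> R.
Hypotheses (g0 : forall x u, 0 <= g x u) (gp : forall x, \sum_u g x u = p x).
Hypothesis gcal : forall u, \sum_x g x u * (x.2%:R - t u) = 0.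

(* The junk value [c x u = 0] when [p x = 0] is harmless: then [g x u = 0]. *)
Let c x u := g x u / p x.

Let cp x u : c x u * p x = g x u.
Proof.
rewrite /c; have [p0|p0] := eqVneq (p x) 0; last by rewrite divfK.
rewrite p0 mulr0; apply/esym/eqP; rewrite eq_le g0 andbT.
by rewrite -p0 -gp (bigD1 u)//= lerDl sumr_ge0.
Qed.

Let sum_p : \sum_x p x = 1.
Proof.
transitivity (\int[J]_(z in pairs) (1 : R)).
  rewrite (Rintegral_cells n0); last exact: bounded_measurable_cst.
  apply: eq_bigr => x _; rewrite Rintegral_cst ?mul1r//; exact: measurable_cell.
rewrite Rintegral_cst; last exact: measurable_pairs.
by rewrite mul1r; exact: (congr1 fine hJ).
Qed.

Let sum_g : \sum_x \sum_u g x u = 1.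
Proof. by under eq_bigr do rewrite gp. Qed.

(** Given that [(v, y)] lies in cell [x], draw [t u] with probability [g x u / p x], independently
    of the position within the cell. The law of [(v, y)] is unchanged, and calibration is exactly
    [gcal], as it sees only [u] and [y]; replacing [v] by its grid point changes the cost by at most
    [1/n]. *)
Lemma coupling_of_plan : exists2 Q, calibrated_couplings J Q &
  \int[Q]_(z in triples) `|z.1.1 - z.1.2| <=
  \sum_x \sum_u g x u * `|t u - t x.1| + n%:R^-1.
Proof.
have [|||Q QE] := @finite_mixture _ _ _ _ R J _ (fun i => c i.1 i.2)
    (fun i => @cell R n i.1) (fun i => attach (t i.2)).
- by move=> i; rewrite divr_ge0// fine_ge0.
- by move=> i; exact: measurable_cell.
- by rewrite -sum_g pair_big; apply: eq_bigr => i _; rewrite cp.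
have triplesP x u z : cell x z -> triples (attach (t u) z).
  move=> /sub_cell_pairs[/= z1 _]; split => //.
  by split; rewrite //= in_itv/= gridpt_itv.
have QtE f : bounded_measurable triples f -> \int[Q]_(z in triples) f z =
    \sum_x \sum_u c x u * \int[J]_(z in cell x) f (t u, z.1, z.2).
  move=> bf; rewrite Rintegral_mkcond QE; last first.
    exact: bounded_measurable_restrict measurable_triples bf.
  rewrite pair_big; apply: eq_bigr => -[x u] _; congr (_ * _).
  apply: eq_Rintegral => z; rewrite inE => zx; rewrite patchE mem_set//.
  exact: triplesP zx.
have mtr := @measurable_triples R.
have probE d (T : measurableType d) (P : probability T R) B : measurable B ->
    P B = (\int[P]_x \1_B x)%:E.
  move=> mB; rewrite /Rintegral integral_indic// setIT fineK//.
  exact: fin_num_measure.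
have Q1 : Q triples = 1%E.
  rewrite probE// QE; last exact: bounded_measurable_indic.
  congr EFin; rewrite -[RHS]sum_g pair_big; apply: eq_bigr => -[x u] _ /=.
  rewrite (@eq_Rintegral _ _ _ _ _ (fun=> 1)).
    by rewrite Rintegral_cst ?mul1r ?cp//; exact: measurable_cell.
  by move=> z; rewrite inE => /triplesP zt; rewrite indicE mem_set.
exists Q; last first.
  have bcost : bounded_measurable triples (fun z : R * R * bool => `|z.1.1 - z.1.2|).
    split.
      apply/measurable_funTS/measurableT_comp => //.
      by apply: measurable_funB; apply: measurableT_comp.
    exists 1 => -[[u v] y] [[/=]]; rewrite !in_itv/= => /andP[u0 u1] /andP[v0 v1] _.
    by rewrite normr_id ler_norml; lra.
  have -> : n%:R^-1 = \sum_x \sum_u g x u * n%:R^-1 :> R.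
    by under eq_bigr do rewrite -mulr_suml; rewrite -mulr_suml sum_g mul1r.
  rewrite QtE// -big_split/=; apply: ler_sum => x _.
  rewrite -big_split/=; apply: ler_sum => u _.
  rewrite -mulrDr -cp -mulrA (mulrC (p x)) ler_wpM2l ?divr_ge0 ?fine_ge0//.
  rewrite -Rintegral_cst; last exact: measurable_cell.
  have mcx := @measurable_cell R n x.
  apply: le_Rintegral => //.
  - apply: bounded_measurable_integrable => //.
    apply: (@bounded_measurable_comp _ _ _ _ _ triples _ (attach (t u))
      (fun z => `|z.1.1 - z.1.2|)) => //; exact: triplesP.
  - by apply: bounded_measurable_integrable => //; exact: bounded_measurable_cst.
  move=> z zx; have := cell_dist zx; have := ler_distD (t x.1) (t u) z.1.
  by rewrite /= (distrC z.1); lra.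
split => //.
- move=> A mA; apply: (etrans (probE _ _ (distribution Q proj_vy) A mA)).
  apply: etrans (esym (probE _ _ J A mA)); congr (_%:E).
  apply: (etrans (@Rintegral_distribution _ _ _ _ _ Q proj_vy _ _)).
    exact: bounded_measurable_indic.
  have mvA : bounded_measurable setT (fun z : R * R * bool => \1_A (proj_vy z) : R).
    exact: (bounded_measurable_comp measurableT (measurable_proj_vy (R := R))
      (fun _ _ => I) (bounded_measurable_indic setT mA)).
  rewrite QE// (Rintegral_full measurable_pairs hJ); last first.
    exact: bounded_measurable_indic.
  rewrite (Rintegral_cells n0); last exact: bounded_measurable_indic.
  rewrite -(pair_bigA _ (fun x u => c x u *
    \int[J]_(z in cell x) \1_A (proj_vy (attach (t u) z)))).
  apply: eq_bigr => x _.
  transitivity (\sum_u c x u * \int[J]_(z in cell x) \1_A z).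
    by apply: eq_bigr => u _; congr (_ * _); apply: eq_Rintegral => -[].
  rewrite -mulr_suml.
  (* In a null cell the weights [c x u] sum to 0 and not to 1, but the integral over the cell
     vanishes as well. *)
  have [p0|p0] := eqVneq (p x) 0; last by rewrite -mulr_suml gp mulfV// mul1r.
  suff -> : \int[J]_(z in cell x) \1_A z = 0 :> R by rewrite mulr0.
  apply/eqP; rewrite eq_le Rintegral_ge0// andbT -p0 -[leRHS]mul1r.
  have mcx := @measurable_cell R n x.
  rewrite -Rintegral_cst//; apply: le_Rintegral => //.
  + by apply: bounded_measurable_integrable => //; exact: bounded_measurable_indic.
  + by apply: bounded_measurable_integrable => //; exact: bounded_measurable_cst.
- have tuy z : triples z -> pairs (@proj_uy R z) by move=> [] [].
  have K1 := distribution_full (X := proj_uy) mtr measurable_pairs Q1 tuy.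
  apply/(calibratedP K1) => A mA.
  have bf := bounded_measurable_residualM
    (bounded_measurable_indic (`[0, 1]%classic : set R) mA).
  rewrite (Rintegral_distribution_pairs (X := proj_uy) mtr)// QtE; last first.
    exact: (bounded_measurable_comp measurable_pairs measurable_proj_uy tuy bf).
  rewrite exchange_big/= big1// => u _.
  transitivity (- \1_A (t u) * \sum_x g x u * (x.2%:R - t u)); last first.
    by rewrite gcal mulr0.
  rewrite mulr_sumr; apply: eq_bigr => x _; rewrite -cp.
  rewrite (@eq_Rintegral _ _ _ _ _ (fun=> (t u - x.2%:R) * \1_A (t u))).
    by rewrite Rintegral_cst; [ring|exact: measurable_cell].
  by move=> z; rewrite inE => -[_ /= ->].
Qed.

End coupling_of_plan.

Lemma distCal_le_smCal (R : realType) (J : probability (R * bool)%type R) :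
  J pairs = 1%E -> distCal J <= 2 * smCal J.
Proof.
move=> hJ; apply/ler_addgt0Pr => e e0.
(* The total error is [5 / n]: [4 / n] from the dual bound and [1 / n] from rounding in the cost. *)
have n0 : (0 < (Num.truncn (5 / e)).+1)%N by [].
have [g [g0 gp gcal gcost]] := grid_plan hJ n0.
have [Q QJ Qcost] := coupling_of_plan hJ n0 g0 gp gcal.
have ne : 5 / (Num.truncn (5 / e)).+1%:R <= e.
  rewrite ler_pdivrMr// -ler_pdivrMl// mulrC.
  exact/ltW/truncnS_gt.
apply: (@le_trans _ _ (\int[Q]_(z in triples) `|z.1.1 - z.1.2|)).
  apply: ge_inf; last by exists Q.
  by exists 0 => _ [P _ <-]; exact: Rintegral_ge0.
rewrite (le_trans Qcost)// (le_trans (lerD gcost (lexx _)))//.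
rewrite -addrA lerD2l (le_trans _ ne)// -[X in _ + X]mul1r -mulrDl.
by rewrite natr1.
Qed.

(** * The smooth calibration error and binning *)

Section smoothing.
Context {R : realType}.
Local Notation mu := (@lebesgue_measure R).
Local Notation U := (uniform_prob (@ltr01 R)).

Lemma is_derive1_continuous (f : R -> R) (x d : R) :
  is_derive x 1 f d -> {for x, continuous f}.
Proof. by move=> [fx _]; exact/differentiable_continuous/derivable1_diffP. Qed.

(* The moving average [x |-> h^-1 \int_x^(x+h) w]. *)
Lemma lipschitz_smoothing (w : R -> R) (h : R) :
  (forall x y, `|w x - w y| <= `|x - y|) -> 0 < h -> exists W W' : R -> R,
  [/\ continuous W', forall x : R, `|W' x| <= 1,
    forall x : R, 0 <= x -> is_derive x 1 W (W' x) &
    forall x : R, 0 <= x -> `|W x - w x| <= h].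
Proof.
move=> wL h0; have cw := lipschitz_continuous wL.
(* Starting at -1 makes 0 an interior point, so that [G] has a two-sided derivative at every
   [x >= 0]. *)
pose G (x : R) : R := \int[mu]_(t in `[-1, x]) w t.
have dG (x : R) : 0 <= x -> is_derive x 1 G (w x).
  move=> x0; have x1 : x < x + 1 by lra.
  have wi : mu.-integrable `[-1, x + 1] (EFin \o w).
    apply: continuous_compact_integrable; first exact: segment_compact.
    exact: continuous_subspaceT.
  have Nx : -1 < x by lra.
  have [Gx GE] := continuous_FTC1_closed x1 wi Nx (cw x).
  by rewrite -GE derive1E; exact: derivableP.
exists (fun x => h^-1 * (G (x + h) - G x)).
exists (fun x => h^-1 * (w (x + h) - w x)); split.
- move=> x; apply: cvgM; first exact: cvg_cst.
  apply: cvgB; last exact: cw.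
  apply: (@continuous_comp _ _ _ (fun x => x + h) w); last exact: cw.
  by apply: cvgD; [exact: cvg_id|exact: cvg_cst].
- move=> x; rewrite normrM normfV (gtr0_norm h0) ler_pdivrMl// mulr1.
  by rewrite (le_trans (wL _ _))// addrAC subrr add0r gtr0_norm.
- move=> x x0.
  have dshift : is_derive x 1 (fun x => x + h) 1 := is_derive_shift x 1 h.
  have xh : 0 <= x + h by lra.
  have dGh : is_derive x 1 (G \o (fun x => x + h)) (w (x + h) * 1).
    exact: (@is_derive1_comp R G (fun x => x + h) x (w (x + h)) 1 (dG _ xh) dshift).
  have := is_deriveZ h^-1 (is_deriveB dGh (dG _ x0)).
  by rewrite mulr1.
move=> x x0; have xh : x < x + h by lra.
(* By the mean value theorem the average over [[x, x + h]] is a value [w c] taken within distance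
   [h] of [x]. *)
have [||c] := @MVT R G w x (x + h) xh.
- by move=> y; rewrite in_itv/= => /andP[xy _]; apply: dG; lra.
- apply: derivable_within_continuous => y; rewrite in_itv/= => /andP[xy _].
  by have [] := dG y (le_trans x0 xy).
rewrite in_itv/= => /andP[xc ch] ->.
have -> : h^-1 * (w c * (x + h - x)) = w c by field; rewrite gt_eqF.
by rewrite (le_trans (wL _ _))// gtr0_norm; lra.
Qed.

Let mu01 : mu (`[0, 1]%classic : set R) = 1%E.
Proof. by rewrite lebesgue_measure_itv/= lte_fin ltr01 oppr0 adde0. Qed.

Let integrable01 (f : R -> R) : bounded_measurable setT f ->
  mu.-integrable `[0, 1] (EFin \o f).
Proof.
move=> [mf [N fN]]; apply: measurable_bounded_integrable => //=.
- by rewrite [X in (X < _)%E]mu01 ltry.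
- exact: measurable_funTS.
- exists N; split; [exact: num_real|move=> N' NN' x _].
  by rewrite /= (le_trans (fN _ _))// ltW.
Qed.

Lemma Rintegral_uniform (f : R -> R) : bounded_measurable setT f ->
  \int[U]_q f q = \int[mu]_(q in `[0, 1]) f q.
Proof.
move=> bf; have [mf [M fM]] := bf.
have bM : bounded_measurable setT (fun _ : R => M) := bounded_measurable_cst _ _.
(* The density formula for the uniform law is applied to a nonnegative function, obtained by adding
   the bound [M]; both measures give the constant the same integral. *)
have bfM := bounded_measurableD bf bM.
have : \int[U]_q (f q + M) = \int[mu]_(q in `[0, 1]) (f q + M).
  rewrite /Rintegral integral_uniform ?subr0 ?invr1 ?mul1e//.
    by apply/measurable_EFinP; case: bfM.
  by move=> q; rewrite lee_fin; have := fM q I; rewrite ler_norml; lra.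
rewrite RintegralD//; try exact: bounded_measurable_integrable.
rewrite RintegralD//; try exact: integrable01.
rewrite !Rintegral_cst// (_ : fine (U _) = 1); last by rewrite probability_setT.
rewrite (_ : fine (mu _) = 1); last exact: (congr1 fine mu01).
by move=> /addIr.
Qed.

Lemma Rintegral_uniform_derive (W W' : R -> R) (v : R) :
  continuous W' -> (forall x : R, `|W' x| <= 1) ->
  (forall x : R, 0 <= x -> is_derive x 1 W (W' x)) -> 0 <= v <= 1 ->
  \int[U]_q (W' q * (q <= v)%R%:R) = W v - W 0.
Proof.
move=> cW' W'1 dW /andP[v0 v1].
have bW' : bounded_measurable setT W'.
  by split; [exact: continuous_measurable_fun cW'|exists 1].
have bv : bounded_measurable setT (fun q : R => (q <= v)%R%:R : R).
  by apply: bounded_measurable_bool; exact: measurable_fun_ler.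
rewrite Rintegral_uniform; last exact: bounded_measurableM.
transitivity (\int[mu]_(q in `[0, v]) W' q).
  rewrite (_ : [set` `[0, v]] = `[0, 1]%classic `&` `[0, v]%classic); last first.
    apply/seteqP; split=> q /=; rewrite !in_itv/=; last by case.
    by move=> /andP[q0 qv]; rewrite q0 qv (le_trans qv v1).
  rewrite Rintegral_mkcondr; apply: eq_Rintegral => q.
  rewrite inE/= in_itv/= => /andP[q0 _].
  by rewrite patchE mem_setE in_itv/= q0; case: (q <= v); rewrite ?mulr1 ?mulr0.
move: v0; rewrite le_eqVlt => /predU1P[<-|v0].
  by rewrite set_itv1 Rintegral_set1 subrr.
rewrite /Rintegral (continuous_FTC2 v0 (F := W))//.
- exact: continuous_subspaceT.
- split.
  + by move=> x; rewrite in_itv/= => /andP[x0 _]; have [] := dW x (ltW x0).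
  + exact/cvg_at_right_filter/(is_derive1_continuous (dW 0 (lexx 0))).
  + exact/cvg_at_left_filter/(is_derive1_continuous (dW v (ltW v0))).
- move=> x; rewrite in_itv/= => /andP[x0 _].
  by rewrite derive1E; have [] := dW x (ltW x0).
Qed.

End smoothing.

(** * Integration by parts: test functions against bins *)

Section smCal_le_l1_ATB.
Context {R : realType} (J : probability (R * bool)%type R).
Hypothesis hJ : J pairs = 1%E.
Local Notation U := (uniform_prob (@ltr01 R)).

Let m := \int[J]_(z in pairs) (z.1 - z.2%:R).

Lemma bin_le1 (b : R * bool -> bool) : measurable_fun setT b ->
  `|\int[J]_(z in pairs) ((z.1 - z.2%:R) * (b z)%:R)| <= 1.
Proof.
move=> mb; apply: normr_Rintegral_le => //.
- exact: measurable_pairs.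
- apply: bounded_measurableM; first exact: bounded_measurable_residual.
  exact: bounded_measurable_bool.
move=> z zp; rewrite normrM mulr_ile1 ?residual_le1//.
by case: (b z); rewrite ?normr1 ?normr0.
Qed.

Lemma bin_lt_le1 q : `|bin_lt J q| <= 1.
Proof.
by apply: (bin_le1 (b := fun z => z.1 < q)); exact: measurable_fun_ltr.
Qed.

Lemma bin_ge_le1 q : `|bin_ge J q| <= 1.
Proof.
by apply: (bin_le1 (b := fun z => q <= z.1)); exact: measurable_fun_ler.
Qed.

Lemma bin_lt_add_ge q : bin_lt J q + bin_ge J q = m.
Proof.
have ib (b : R * bool -> bool) : measurable_fun setT b -> J.-integrable pairs
    (EFin \o (fun z : R * bool => (z.1 - z.2%:R) * (b z)%:R)).
  move=> mb; apply: bounded_measurable_integrable; first exact: measurable_pairs.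
  apply: bounded_measurableM; first exact: bounded_measurable_residual.
  exact: bounded_measurable_bool.
rewrite /bin_lt /bin_ge -RintegralD.
- apply: eq_Rintegral => z _; rewrite -mulrDr leNgt.
  by case: (z.1 < q); rewrite /= ?addr0 ?add0r mulr1.
- exact: measurable_pairs.
- by apply: (ib (fun z => z.1 < q)); exact: measurable_fun_ltr.
- by apply: (ib (fun z => q <= z.1)); exact: measurable_fun_ler.
Qed.

Lemma bounded_measurable_l1 :
  bounded_measurable setT (fun q => `|bin_lt J q| + `|bin_ge J q|).
Proof.
by apply: bounded_measurableD; apply: bounded_measurable_norm;
  [exact: bounded_measurable_bin_lt|exact: bounded_measurable_bin_ge].
Qed.

Let U1 : fine (U setT) = 1. Proof. by rewrite probability_setT. Qed.

Lemma l1_ATB_ge0 : 0 <= l1_ATB J.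
Proof. by apply: Rintegral_ge0 => q _; rewrite addr_ge0. Qed.

Lemma l1_ATB_le2 : l1_ATB J <= 2.
Proof.
have <- : \int[U]_q 2 = 2 :> R by rewrite Rintegral_cst// U1 mulr1.
apply: le_Rintegral => //.
- by apply: bounded_measurable_integrable => //; exact: bounded_measurable_l1.
- by apply: bounded_measurable_integrable => //; exact: bounded_measurable_cst.
by move=> q _; have := bin_lt_le1 q; have := bin_ge_le1 q; lra.
Qed.

Let m_le : `|m| <= l1_ATB J.
Proof.
have <- : \int[U]_q `|m| = `|m| by rewrite Rintegral_cst// U1 mulr1.
apply: le_Rintegral => //.
- by apply: bounded_measurable_integrable => //; exact: bounded_measurable_cst.
- by apply: bounded_measurable_integrable => //; exact: bounded_measurable_l1.
by move=> q _; rewrite -(bin_lt_add_ge q) ler_normD.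
Qed.

(* Integration by parts: [W v = W 0 + \int_0^v W'] and Fubini turn
   [E[(v - y) W v]] into [m * W 0 + \int W' q * bin_ge q dq]; the symmetric
   form below follows from [bin_lt + bin_ge = m]. *)
Lemma residual_smooth (W W' : R -> R) :
  continuous W' -> (forall x : R, `|W' x| <= 1) ->
  (forall x : R, 0 <= x -> is_derive x 1 W (W' x)) ->
  bounded_measurable (`[0, 1]%classic : set R) W ->
  2 * \int[J]_(z in pairs) ((z.1 - z.2%:R) * W z.1) =
  m * (W 0 + W 1) + \int[U]_q (W' q * (bin_ge J q - bin_lt J q)).
Proof.
move=> cW' W'1 dW bW.
have bW' : bounded_measurable setT W'.
  by split; [exact: continuous_measurable_fun cW'|exists 1].
have bstep v : bounded_measurable setT (fun q : R => (q <= v)%R%:R : R).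
  by apply: bounded_measurable_bool; exact: measurable_fun_ler.
pose f (x : (R * bool) * R) : R :=
  ((fun z : R * bool => z.1 - z.2%:R) \_ pairs) x.1 *
  (W' x.2 * (x.2 <= x.1.1)%R%:R).
have bf : bounded_measurable setT f.
  apply: bounded_measurableM.
    apply: (bounded_measurable_comp measurableT measurable_fst _ _) => //.
    apply: bounded_measurable_restrict; first exact: measurable_pairs.
    exact: bounded_measurable_residual.
  apply: bounded_measurableM.
    exact: (bounded_measurable_comp measurableT measurable_snd _ bW').
  apply: bounded_measurable_bool; apply: measurable_fun_ler => //.
  exact: measurableT_comp.
have ip (g : R * bool -> R) : bounded_measurable pairs g ->
    J.-integrable pairs (EFin \o g).
  by apply: bounded_measurable_integrable; exact: measurable_pairs.
have fubini : \int[J]_(z in pairs) ((z.1 - z.2%:R) * (W z.1 - W 0)) =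
    \int[U]_q (W' q * bin_ge J q).
  transitivity (\int[J]_z \int[U]_q f (z, q)).
    rewrite Rintegral_mkcond; apply: eq_Rintegral => z _.
    have iz : U.-integrable setT (EFin \o (fun q => W' q * (q <= z.1)%R%:R)).
      apply: bounded_measurable_integrable => //.
      exact: (bounded_measurableM bW' (bstep _)).
    have -> : \int[U]_q f (z, q) = ((fun z : R * bool => z.1 - z.2%:R) \_ pairs) z *
        \int[U]_q (W' q * (q <= z.1)%R%:R) by rewrite -RintegralZl.
    rewrite !patchE; have [|_] := boolP (z \in pairs); last by rewrite mul0r.
    rewrite inE => -[/=]; rewrite in_itv/= => z1 _.
    by rewrite (Rintegral_uniform_derive cW' W'1 dW).
  rewrite (Rintegral_Fubini J U bf); apply: eq_Rintegral => q _.
  rewrite -RintegralZl; last 2 first.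
  - exact: measurable_pairs.
  - apply: ip; apply: bounded_measurableM; first exact: bounded_measurable_residual.
    by apply: bounded_measurable_bool; exact: measurable_fun_ler.
  rewrite [RHS]Rintegral_mkcond; apply: eq_Rintegral => z _.
  by rewrite /f/= !patchE; case: ifP => _; rewrite ?mul0r//; ring.
have W'E : \int[U]_q W' q = W 1 - W 0.
  rewrite -(Rintegral_uniform_derive cW' W'1 dW (v := 1)) ?ler01 ?lexx//.
  rewrite !Rintegral_uniform//; last exact: (bounded_measurableM bW' (bstep _)).
  apply: eq_Rintegral => q; rewrite inE/= in_itv/= => /andP[_ ->].
  by rewrite mulr1.
have iU (g : R -> R) : bounded_measurable setT g -> U.-integrable setT (EFin \o g).
  exact: (bounded_measurable_integrable U measurableT).
have bge := bounded_measurable_bin_ge J.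
have -> : \int[U]_q (W' q * (bin_ge J q - bin_lt J q)) =
    2 * \int[U]_q (W' q * bin_ge J q) - m * (W 1 - W 0).
  rewrite -W'E -!RintegralZl//; [|exact: iU|by apply: iU; exact: bounded_measurableM].
  rewrite -RintegralB//.
  - by apply: eq_Rintegral => q _; rewrite -(bin_lt_add_ge q); ring.
  - apply: iU; apply: bounded_measurableM; last exact: bounded_measurableM.
    exact: bounded_measurable_cst.
  - by apply: iU; apply: bounded_measurableM => //; exact: bounded_measurable_cst.
rewrite -fubini.
have -> : \int[J]_(z in pairs) ((z.1 - z.2%:R) * (W z.1 - W 0)) =
    \int[J]_(z in pairs) ((z.1 - z.2%:R) * W z.1) - m * W 0.
  rewrite /m -RintegralZr; last 2 first.
  - exact: measurable_pairs.
  - exact/ip/bounded_measurable_residual.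
  rewrite -RintegralB.
  - by apply: eq_Rintegral => z _; rewrite mulrBr.
  - exact: measurable_pairs.
  - by apply: ip; exact: bounded_measurable_residualM.
  - apply: ip; apply: bounded_measurableM; first exact: bounded_measurable_residual.
    exact: bounded_measurable_cst.
by ring.
Qed.

Lemma smCal_le_l1_ATB : smCal J <= 3 / 2 * l1_ATB J.
Proof.
apply: smCal_le => w /[dup] ww /W1_clip[wL w1].
apply/ler_addgt0Pr => e e0.
(* Replacing [w] by [W] costs [e / 3]. Bounding [|W 0 + W 1|] by [2 + 2 * (e / 3)] costs
   [2 * (e / 3)] after halving, since [l1_ATB J <= 2]. The total is [e]. *)
have h0 : 0 < e / 3 by lra.
have [W [W' [cW' W'1 dW Ww]]] := lipschitz_smoothing wL h0.
have WB x : 0 <= x -> `|W x| <= 1 + e / 3.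
  move=> x0; have := Ww x x0; have := w1 x.
  have := ler_distD (w (clip 0 1 x)) (W x) 0.
  by rewrite !subr0; lra.
have cW : {within `[0, 1], continuous W}.
  apply: derivable_within_continuous => x; rewrite in_itv/= => /andP[x0 _].
  by have [] := dW x x0.
have bW : bounded_measurable (`[0, 1]%classic : set R) W.
  split; first exact: subspace_continuous_measurable_fun.
  by exists (1 + e / 3) => x; rewrite /= in_itv/= => /andP[x0 _]; exact: WB.
have ip (g : R * bool -> R) : bounded_measurable pairs g ->
    J.-integrable pairs (EFin \o g).
  by apply: bounded_measurable_integrable; exact: measurable_pairs.
have bw := bounded_measurable_residualM (bounded_measurable_W1 ww).
have bWr := bounded_measurable_residualM bW.
have wW : \int[J]_(z in pairs) ((z.1 - z.2%:R) * w z.1) <=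
    \int[J]_(z in pairs) ((z.1 - z.2%:R) * W z.1) + e / 3.
  have <- : \int[J]_(z in pairs) (e / 3) = e / 3.
    rewrite Rintegral_cst; last exact: measurable_pairs.
    by rewrite (_ : fine _ = 1) ?mulr1//; exact: (congr1 fine hJ).
  have bc : bounded_measurable (@pairs R) (fun=> e / 3).
    exact: bounded_measurable_cst.
  rewrite -RintegralD; first last.
  - exact: ip.
  - exact: ip.
  - exact: measurable_pairs.
  apply: le_Rintegral.
  - exact: measurable_pairs.
  - exact: ip.
  - by apply: ip; exact: bounded_measurableD.
  move=> z zp; rewrite -lerBlDl -mulrBr (le_trans (ler_norm _))// normrM.
  case: (zp) => /=; rewrite in_itv/= => z01 _.
  rewrite -[leRHS]mul1r ler_pM ?residual_le1// distrC.
  by have := Ww z.1; case/andP: (z01) => z0 _; rewrite clip_id//; exact.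
have := residual_smooth cW' W'1 dW bW.
have mW : m * (W 0 + W 1) <= l1_ATB J * (2 + 2 * (e / 3)).
  rewrite (le_trans (ler_norm _))// normrM ler_pM// ?m_le//.
  have := WB 0 (lexx 0); have := WB 1 ler01; have := ler_normD (W 0) (W 1); lra.
have Wl1 : \int[U]_q (W' q * (bin_ge J q - bin_lt J q)) <= l1_ATB J.
  apply: le_Rintegral => //.
  - apply: bounded_measurable_integrable => //; apply: bounded_measurableM.
      by split; [exact: continuous_measurable_fun cW'|exists 1].
    by apply: bounded_measurableB; [exact: bounded_measurable_bin_ge|
      exact: bounded_measurable_bin_lt].
  - by apply: bounded_measurable_integrable => //; exact: bounded_measurable_l1.
  move=> q _; rewrite (le_trans (ler_norm _))// normrM -[leRHS]mul1r ler_pM//.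
  by rewrite addrC -[`|bin_lt J q|]normrN ler_normD.
have l1e : l1_ATB J * (e / 3) <= 2 * (e / 3).
  by rewrite ler_wpM2r ?l1_ATB_le2// ltW.
move: wW mW Wl1 l1e; lra.
Qed.

End smCal_le_l1_ATB.

Lemma l1_ATB_le_distCal (R : realType) (J : probability (R * bool)%type R) :
  J pairs = 1%E -> l1_ATB J <= 3 * distCal J.
Proof.
move=> hJ; rewrite -ler_pdivrMl//; apply: lb_le_inf => [|_ [Pi PiJ <-]]; last first.
  by rewrite ler_pdivrMl// l1_ATB_le_coupling.
(* A bound valid for all couplings passes to the infimum only if there is one, the infimum of the
   empty set being 0 by convention; the plan on the coarsest grid provides it. *)
have n0 : (0 < 1)%N by [].
have [g [g0 gp gcal _]] := grid_plan hJ n0.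
have [Q QJ _] := coupling_of_plan hJ n0 g0 gp gcal.
by eexists; exists Q.
Qed.

Lemma distCal_ge0 (R : realType) (J : probability (R * bool)%type R) :
  J pairs = 1%E -> 0 <= distCal J.
Proof.
move=> hJ; have := le_trans (l1_ATB_ge0 J) (l1_ATB_le_distCal hJ).
by rewrite pmulr_rge0.
Qed.

(** * Comparison of the quadratic and absolute binning errors *)

Section ATB_l1_ATB.
Context {R : realType} (J : probability (R * bool)%type R).
Local Notation U := (uniform_prob (@ltr01 R)).

Let bin2 : bounded_measurable setT (fun q => bin_lt J q ^+ 2 + bin_ge J q ^+ 2).
Proof.
by apply: bounded_measurableD; apply: bounded_measurableM;
  exact: bounded_measurable_bin_lt || exact: bounded_measurable_bin_ge.
Qed.

Let iU (f : R -> R) : bounded_measurable setT f ->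
  U.-integrable setT (EFin \o f).
Proof. exact: (bounded_measurable_integrable U measurableT). Qed.

Lemma ATB_le_l1_ATB : ATB J <= l1_ATB J.
Proof.
apply: le_Rintegral => //; first exact: iU.
  exact/iU/bounded_measurable_l1.
move=> q _; rewrite lerD// -real_normK ?num_real// expr2 ler_piMl//.
  exact: bin_lt_le1.
exact: bin_ge_le1.
Qed.

(** Jensen in tangent form: with [X] the sum of the absolute bins, of mean [l], the inequality
    [2 * l * X - l ^+ 2 <= X ^+ 2] integrates to the square of [l] on the left. The factor 2 is from
    [(a + b) ^+ 2 <= 2 * (a ^+ 2 + b ^+ 2)]. *)
Lemma sqr_l1_ATB_le : l1_ATB J ^+ 2 <= 2 * ATB J.
Proof.
set l := l1_ATB J.
have bl := bounded_measurable_l1 J.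
have bcst (k : R) : bounded_measurable setT (fun _ : R => k).
  exact: bounded_measurable_cst.
have -> : l ^+ 2 =
    \int[U]_q (2 * l * (`|bin_lt J q| + `|bin_ge J q|) - l ^+ 2).
  rewrite RintegralB//; last 2 first.
  - by apply: iU; exact: bounded_measurableM.
  - exact: iU.
  rewrite RintegralZl//; last exact: iU.
  have U1 : fine (U setT) = 1 by rewrite probability_setT.
  rewrite Rintegral_cst// U1.
  by rewrite -/(l1_ATB J) -/l; ring.
rewrite /ATB -[leRHS]RintegralZl//; last exact: iU.
apply: le_Rintegral => //.
- by apply: iU; apply: bounded_measurableB => //; exact: bounded_measurableM.
- by apply: iU; exact: bounded_measurableM.
move=> q _; rewrite -(real_normK (num_real (bin_lt J q))).
rewrite -(real_normK (num_real (bin_ge J q))).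
have := sqr_ge0 (l - (`|bin_lt J q| + `|bin_ge J q|)).
have := sqr_ge0 (`|bin_lt J q| - `|bin_ge J q|).
lra.
Qed.

End ATB_l1_ATB.

Theorem corollary4p5 (R : realType) (J : probability (R * bool)%type R)
    (hJ : J pairs = 1%E) :
  [/\ 1 / 3 * distCal J <= 2 / 3 * smCal J,
      2 / 3 * smCal J <= l1_ATB J,
      l1_ATB J <= 3 * distCal J &
      3 * distCal J <= 6 * smCal J] /\
  [/\ 1 / 18 * distCal J ^+ 2 <= 2 / 9 * smCal J ^+ 2,
      2 / 9 * smCal J ^+ 2 <= ATB J,
      ATB J <= 3 * distCal J &
      3 * distCal J <= 6 * smCal J].
Proof.
have d_ge0 := distCal_ge0 hJ.
have d_s := distCal_le_smCal hJ.
have s_l := smCal_le_l1_ATB hJ.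
have l_d := l1_ATB_le_distCal hJ.
have a_l := ATB_le_l1_ATB J.
have l2_a := sqr_l1_ATB_le J.
(* Squaring is monotone here because [d_ge0] makes all three quantities nonnegative. The constants
   are [2/9 = 1/2 * (2/3) ^+ 2] and [1/18 = 2/9 * (1/2) ^+ 2]. *)
have d2_s2 : distCal J ^+ 2 <= (2 * smCal J) ^+ 2.
  by rewrite ler_sqr ?nnegrE//; lra.
have s2_l2 : smCal J ^+ 2 <= (3 / 2 * l1_ATB J) ^+ 2.
  by rewrite ler_sqr ?nnegrE//; lra.
by split; split; lra.
Qed.
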